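(* Let $G$ be a topological group. The following are equivalent: (1) $G$ is amenable; (2) $L^{0}(G)$ is amenable; (3) $L^{0}(G)$ is extremely amenable; (4) $L^{0}(G)$ is whirly amenable.
   Context: Let $\lambda$ be Lebesgue measure on $[0,1]$. A map $f\colon [0,1]\to G$ is strongly $\lambda$-measurable if for every $\epsilon>0$ there is a closed set $A\subseteq[0,1]$ with $\lambda([0,1]\setminus A)\le\epsilon$ such that $f|_A$ is continuous. $L^{0}(G)$ is the set of $\lambda$-almost-everywhere equivalence classes of strongly $\lambda$-measurable maps $[0,1]\to G$, with pointwise group operations, and the topology of convergence in measure: a neighbourhood basis of the identity is given by the sets $N(U,\epsilon)=\{f\in L^0(G) : \lambda(\{x : f(x)\notin U\})<\epsilon\}$, for $U$ an open neighbourhood of the identity $e$ in $G$ and $\epsilon>0$. A topological group $G$ carries its right uniformity, with basic entourages $\{(x,y): xy^{-1}\in U\}$ for identity neighbourhoods $U$; $\mathrm{RUC}_b(G)$ is the space of bounded real-valued functions on $G$ uniformly continuous for this uniformity. $G$ is amenable if there is a left-invariant mean on $\mathrm{RUC}_b(G)$, i.e. a positive linear functional $\mu$ with $\mu(\mathbf 1)=1$ and $\mu(f\circ\lambda_g)=\mu(f)$ for all $f$ and $g\in G$, where $\lambda_g(x)=gx$. $G$ is extremely amenable if every continuous action of $G$ on a compact Hausdorff space has a fixed point. $G$ is whirly amenable if $G$ is amenable and, for every continuous action of $G$ on a compact Hausdorff space $X$, every $G$-invariant regular Borel probability measure on $X$ is supported on the set of $G$-fixed points. *)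

(* Defs.v *)
From HB Require Import structures.
From mathcomp Require Import all_boot all_order all_algebra.
From mathcomp Require Import all_classical all_reals.
From mathcomp Require Import all_analysis.
Set Implicit Arguments.
Unset Strict Implicit.
Unset Printing Implicit Defensive.
Import Order.TTheory GRing.Theory Num.Theory numFieldNormedType.Exports.
Local Open Scope classical_set_scope.
Local Open Scope ring_scope.

Section TopGroupNotions.
Variables (R : realType) (G : topologicalType)
  (mul : G -> G -> G) (inv : G -> G) (one : G).

Definition is_topgroup : Prop :=
  [/\ (forall x y z, mul x (mul y z) = mul (mul x y) z),
      (forall x, mul one x = x /\ mul x one = x),
      (forall x, mul (inv x) x = one /\ mul x (inv x) = one),
      continuous (fun p : G * G => mul p.1 p.2) &
      continuous inv].

Definition RUCb (f : G -> R) : Prop :=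
  (exists M : R, forall x, `|f x| <= M) /\
  (forall eps : R, 0 < eps -> exists U : set G, nbhs one U /\
     forall x y, U (mul x (inv y)) -> `|f x - f y| < eps).

(* a left-invariant mean on RUC_b(G) (mu is only constrained on RUC_b) *)
Definition left_invariant_mean (mu : (G -> R) -> R) : Prop :=
  [/\ (forall f g, RUCb f -> RUCb g -> mu (f \+ g) = mu f + mu g),
      (forall (a : R) f, RUCb f -> mu (fun x => a * f x) = a * mu f),
      (forall f, RUCb f -> (forall x, 0 <= f x) -> 0 <= mu f),
      mu (fun _ => 1) = 1 &
      (forall f g, RUCb f -> mu (fun x => f (mul g x)) = mu f)].

Definition amenable : Prop := exists mu, left_invariant_mean mu.

Definition continuous_action (X : topologicalType) (act : G -> X -> X) : Prop :=
  [/\ (forall x, act one x = x),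
      (forall g h x, act (mul g h) x = act g (act h x)) &
      continuous (fun p : G * X => act p.1 p.2)].

Definition fixed_points (X : topologicalType) (act : G -> X -> X) : set X :=
  [set x | forall g, act g x = x].

(* nonempty (pointed) compact Hausdorff spaces *)
Definition extremely_amenable : Prop :=
  forall (X : ptopologicalType) (act : G -> X -> X),
    compact [set: X] -> hausdorff_space X -> continuous_action act ->
    exists x, fixed_points act x.

Definition Borel (X : ptopologicalType) := g_sigma_algebraType (@open X).

Definition regular_measure (X : ptopologicalType)
    (mu : set (Borel X) -> \bar R) : Prop :=
  forall A : set (Borel X), measurable A ->
    mu A = ereal_sup [set mu K | K in [set K : set X | compact K /\ K `<=` A]]
    /\ mu A = ereal_inf [set mu U | U in [set U : set X | open U /\ A `<=` U]].

Definition whirly_amenable : Prop :=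
  amenable /\
  forall (X : ptopologicalType) (act : G -> X -> X),
    compact [set: X] -> hausdorff_space X -> continuous_action act ->
    forall mu : probability (Borel X) R,
      regular_measure mu ->
      (forall g (A : set (Borel X)), measurable A ->
          mu ((act g) @^-1` A) = mu A) ->
      mu (~` (fixed_points act : set (Borel X))) = 0%E.

End TopGroupNotions.

Section L0.
Variables (R : realType) (G : topologicalType)
  (mul : G -> G -> G) (inv : G -> G) (one : G).

Local Notation lambda := (@lebesgue_measure R).
Local Notation I01 := (`[(0:R), 1]%classic : set R).

(* maps are represented as functions R -> G; only their values on [0,1]
   matter, since they are identified up to null sets of [0,1] *)
Definition strongly_measurable (f : R -> G) : Prop :=
  forall eps : R, 0 < eps -> exists A : set R,
    [/\ closed A, A `<=` I01, (lambda (I01 `\` A) <= eps%:E)%E &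
        {within A, continuous f}].

(* lambda is the Lebesgue outer measure, equal to Lebesgue measure on
   Lebesgue measurable sets *)
Definition ae_eq (f g : R -> G) : Prop :=
  lambda [set x | I01 x /\ f x <> g x] = 0%E.

Definition L0class (f : R -> G) : set (R -> G) :=
  [set g | strongly_measurable g /\ ae_eq f g].

Definition is_L0class (C : set (R -> G)) : Prop :=
  exists f, strongly_measurable f /\ C = L0class f.

Definition L0car := {C : set (R -> G) | is_L0class C}.
HB.instance Definition _ := gen_eqMixin L0car.
HB.instance Definition _ := gen_choiceMixin L0car.

Definition L0rep (C : L0car) : R -> G := sval (cid (svalP C)).

Lemma strongly_measurable_cst (a : G) : strongly_measurable (fun _ => a).
Proof.
move=> eps eps0; exists I01; split.
- exact: interval_closed.
- by [].
- by rewrite setDv measure0 lee_fin ltW.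
- by move=> x; apply: cvg_cst.
Qed.

Definition L0one : L0car :=
  exist _ (L0class (fun _ => one)) (ex_intro _ _ (conj (strongly_measurable_cst one) erefl)).

(* the class of a map f (which is strongly measurable whenever the
   arguments are; the fallback value is never used) *)
Definition L0of (f : R -> G) : L0car :=
  match pselect (is_L0class (L0class f)) with
  | left p => exist _ (L0class f) p
  | right _ => L0one
  end.

Definition L0mul (C D : L0car) : L0car :=
  L0of (fun x => mul (L0rep C x) (L0rep D x)).
Definition L0inv (C : L0car) : L0car := L0of (fun x => inv (L0rep C x)).

Definition L0N (U : set G) (eps : R) : set L0car :=
  [set C | (lambda [set x | I01 x /\ ~ U (L0rep C x)] < eps%:E)%E].

(* topology of convergence in measure: the group topology in which the
   N(U, eps) (U open nbhd of one, eps > 0) form a neighbourhood basis of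
   the identity; a set is open iff it contains a translate C N(U,eps) of
   such a set around each of its points C *)
Definition L0open (A : set L0car) : Prop :=
  forall C, A C -> exists (U : set G) (eps : R),
    [/\ open U, U one, 0 < eps & forall D, L0N U eps D -> A (L0mul C D)].

End L0.

(* L^0(G) as a topological space; the type carries the group data used to
   define its topology *)
Definition L0 (R : realType) (G : topologicalType)
  (mul : G -> G -> G) (one : G) : Type := L0car R G.

Section L0top.
Variables (R : realType) (G : topologicalType)
  (mul : G -> G -> G) (inv : G -> G) (one : G).
HB.instance Definition _ := Choice.on (@L0 R G mul one).
HB.instance Definition _ := @isSubBaseTopological.Build (@L0 R G mul one)
  (set (@L0car R G)) (@L0open R G mul one) id.

Definition L0m : @L0 R G mul one -> @L0 R G mul one -> @L0 R G mul one :=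
  @L0mul R G mul one.
Definition L0i : @L0 R G mul one -> @L0 R G mul one := @L0inv R G inv one.
Definition L0e : @L0 R G mul one := @L0one R G one.
End L0top.

(* Main.v *)
(* G to L^0(G): let psi be a bounded right uniformly continuous function on
   L^0(G), restricted to step functions with N equal cells, that is to G^N. Up to
   a uniformly small error it may be replaced by an inf-convolution that is
   O(1/N)-Lipschitz in each coordinate, so its variance under any product
   probability nu^N is O(1/N), while an almost invariant nu makes its mean
   almost invariant under translation by G^N. Hence psi(g h) - psi(h) is small on
   average over h. As nu can be chosen uniformly over equicontinuous families
   (Hahn-Banach applied to an invariant mean), this holds for all orbit
   functions h |-> phi(h x), x in X, at once: it produces fixed points, and by
   averaging an invariant measure shows that it lives on the fixed points.
   Back to G: extreme amenability gives a fixed point in the compact space of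
   means of L^0(G), and a mean m on L^0(G) induces the mean
   f |-> m(C |-> int f(C(x)) dx) on G. *)
Require Import Defs.
From HB Require Import structures.
From mathcomp Require Import all_boot all_order all_algebra.
From mathcomp Require Import all_classical all_reals all_analysis.
From mathcomp Require Import measurable_realfun.
From mathcomp Require Import ring lra.
Import Defs.
Set Implicit Arguments.
Unset Strict Implicit.
Unset Printing Implicit Defensive.
Import Order.TTheory GRing.Theory Num.Theory numFieldNormedType.Exports.
Local Open Scope classical_set_scope.
Local Open Scope ring_scope.

(** * Hahn-Banach for bounded functions *)

(** Uniform continuity only controls [psi] when two step functions differ on a set of small measure.
    It gives no rate in [1 / N] for one changed cell, whereas a variance bound needs [N] squared
    oscillations with a small sum. The Lipschitz replacement supplies this: with slope [2 / (d * N)]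
    the sum is [4 / (d ^ 2 * N)]. The order of the choices is rigid. [N] comes before [nu], whose
    invariance error must be of order [1 / N], because the cells are translated in turn and the
    errors add up. While one cell moves, the other coordinates are arbitrary, so [nu] must be almost
    invariant on an infinite family of one-variable sections; these share one modulus of continuity
    because left translations do not increase the Hamming distance. Invariance is applied to squared
    deviations from the mean, so that the values at [h] and at [g h] are both close in square mean
    to the same constant. Lebesgue measure acts as an outer measure on arbitrary subsets, so
    exceptional sets never have to be shown measurable. *)

Definition bounded_fct (R : realType) (T : Type) (v : T -> R) : Prop :=
  exists M : R, forall x, `|v x| <= M.

Section BoundedFct.
Variables (R : realType) (T : Type).
Implicit Types v w : T -> R.

Lemma bounded_fctD v w : bounded_fct v -> bounded_fct w ->
  bounded_fct (v \+ w).
Proof.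
move=> [M vM] [N wN]; exists (M + N) => x.
by rewrite (le_trans (ler_normD _ _))// lerD.
Qed.

Lemma bounded_fctZ (a : R) v : bounded_fct v ->
  bounded_fct (fun x => a * v x).
Proof.
move=> [M vM]; exists (`|a| * M) => x.
by rewrite normrM ler_wpM2l.
Qed.

Lemma bounded_fct_cst (a : R) : bounded_fct (fun _ : T => a).
Proof. by exists `|a|. Qed.

End BoundedFct.

Section HahnBanach.
Variables (R : realType) (T : Type).
Implicit Types v w : T -> R.

Definition sublinear (q : (T -> R) -> R) : Prop :=
  (forall v w, bounded_fct v -> bounded_fct w -> q (v \+ w) <= q v + q w) /\
  (forall (a : R) v, 0 <= a -> bounded_fct v -> q (fun x => a * v x) = a * q v).

Lemma sublinear0 q : sublinear q -> q (fun _ => 0) = 0.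
Proof.
move=> [_ /(_ 0 _ (lexx 0) (bounded_fct_cst T 0))]; by rewrite !mul0r.
Qed.

Lemma sublinear_geN q v : sublinear q -> bounded_fct v ->
  - q (fun x => -1 * v x) <= q v.
Proof.
move=> sq bv; rewrite -subr_ge0 opprK.
have := sq.1 _ _ bv (bounded_fctZ (-1) bv).
rewrite (_ : v \+ _ = fun _ => 0) ?(sublinear0 sq)//.
by apply/funext => x /=; rewrite mulN1r subrr.
Qed.

(* q_w(v) = inf_(t >= 0) q(v + t w) - t q(w) is a sublinear functional below q;
   minimality of q forces q_w = q, hence q(v) + q(w) <= q(v + w). *)
Lemma minimal_sublinear_additive q : sublinear q ->
  (forall q', sublinear q' -> (forall v, bounded_fct v -> q' v <= q v) ->
     forall v, bounded_fct v -> q v <= q' v) ->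
  forall v w, bounded_fct v -> bounded_fct w -> q (v \+ w) = q v + q w.
Proof.
move=> sq qmin v w bv bw; apply/eqP; rewrite eq_le sq.1//=.
pose A u := [set q (u \+ (fun x => t * w x)) - t * q w | t in [set t | 0 <= t]].
pose q' u := inf (A u).
have btw t : bounded_fct (fun x => t * w x) by exact: bounded_fctZ.
have lbA u : bounded_fct u -> lbound (A u) (- q (fun x => -1 * u x)).
  move=> bu _ [t /= t0 <-]; rewrite lerBrDr addrC lerBlDr.
  rewrite -(sq.2 _ _ t0 bw).
  have := sq.1 _ _ (bounded_fctD bu (btw t)) (bounded_fctZ (-1) bu).
  rewrite (_ : (u \+ (fun x => t * w x)) \+ (fun x => -1 * u x) = fun x => t * w x) //.
  by apply/funext => x /=; rewrite mulN1r addrAC subrr add0r.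
have hA u : bounded_fct u -> has_inf (A u).
  move=> bu; split; last by exists (- q (fun x => -1 * u x)); exact: lbA.
  by exists (q (u \+ (fun x => 0 * w x)) - 0 * q w); exists 0 => /=.
have q'le u t : bounded_fct u -> 0 <= t ->
    q' u <= q (u \+ (fun x => t * w x)) - t * q w.
  move=> bu t0; apply: ge_inf; first exact: (hA _ bu).2.
  by exists t.
have q'ge u c : bounded_fct u ->
   (forall t, 0 <= t -> c <= q (u \+ (fun x => t * w x)) - t * q w) -> c <= q' u.
  move=> bu ct; apply: lb_le_inf; first exact: (hA _ bu).1.
  by move=> _ [t t0 <-]; exact: ct.
have sq' : sublinear q'.
  split=> [u1 u2 b1 b2|a u].
    rewrite -lerBlDr; apply: (q'ge) => // t1 t10; rewrite lerBlDr.
    rewrite -lerBlDl; apply: (q'ge) => // t2 t20; rewrite lerBlDl.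
    apply: (le_trans (q'le _ (t1 + t2) (bounded_fctD b1 b2) (addr_ge0 t10 t20))).
    have := sq.1 _ _ (bounded_fctD b1 (btw t1)) (bounded_fctD b2 (btw t2)).
    rewrite (_ : _ \+ _ = (u1 \+ u2) \+ (fun x => (t1 + t2) * w x)).
      by move=> ?; lra.
    by apply/funext => x /=; ring.
  rewrite le_eqVlt => /predU1P[<- bu|a0 bu].
    rewrite mul0r; apply/eqP; rewrite eq_le; apply/andP; split.
      apply: (le_trans (q'le _ 0 (bounded_fctZ _ bu) (lexx 0))).
      rewrite (_ : _ \+ _ = fun _ => 0) ?(sublinear0 sq)//; first by rewrite mul0r subr0.
      by apply/funext => x /=; rewrite !mul0r addr0.
    apply: (q'ge); first exact: bounded_fctZ.
    move=> t t0; rewrite (_ : _ \+ _ = fun x => t * w x).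
      by rewrite sq.2// subrr.
    by apply/funext => x /=; rewrite !mul0r add0r.
  apply/eqP; rewrite eq_le; apply/andP; split.
    rewrite -ler_pdivrMl//; apply: (q'ge) => // t t0.
    rewrite ler_pdivrMl//.
    apply: (le_trans (q'le _ (a * t) (bounded_fctZ _ bu) (mulr_ge0 (ltW a0) t0))).
    rewrite mulrBr mulrA lerB// -(sq.2 _ _ (ltW a0) (bounded_fctD bu (btw t))).
    by rewrite (_ : _ \+ _ = (fun x => a * (u \+ (fun x => t * w x)) x))//;
      apply/funext => x /=; ring.
  apply: (q'ge); first exact: bounded_fctZ.
  move=> t t0; rewrite -ler_pdivlMl//.
  have t'0 : 0 <= a^-1 * t by rewrite mulr_ge0// invr_ge0 ltW.
  apply: (le_trans (q'le _ (a^-1 * t) bu t'0)).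
  rewrite mulrBr mulrA lerB//.
  have ia0 : 0 <= a^-1 by rewrite invr_ge0 ltW.
  rewrite -(sq.2 _ _ ia0 (bounded_fctD (bounded_fctZ a bu) (btw t))).
  by rewrite (_ : _ \+ _ = (fun x => a^-1 *
      ((fun x => a * u x) \+ (fun x => t * w x)) x))//;
    apply/funext => x /=; field; rewrite gt_eqF.
have q'q u : bounded_fct u -> q' u <= q u.
  move=> bu; apply: (le_trans (q'le _ 0 bu (lexx 0))).
  rewrite (_ : _ \+ _ = u) ?mul0r ?subr0//.
  by apply/funext => x /=; rewrite mul0r addr0.
have := qmin _ sq' q'q v bv => /le_trans/(_ (q'le v 1 bv ler01)).
rewrite mul1r lerBrDr (_ : _ \+ (fun x => 1 * w x) = v \+ w)//.
by apply/funext => x /=; rewrite mul1r.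
Qed.

(** Zorn's lemma descends among the sublinear functionals below [p] instead of extending from
    subspaces. The pointwise infimum of a chain is finite, being at least [- p (- v)], and again
    sublinear; a minimal element is additive, hence linear. *)
Lemma exists_linear_below (p : (T -> R) -> R) : sublinear p ->
  exists F : (T -> R) -> R,
  [/\ forall v w, bounded_fct v -> bounded_fct w -> F (v \+ w) = F v + F w,
      forall (a : R) v, bounded_fct v -> F (fun x => a * v x) = a * F v &
      forall v, bounded_fct v -> F v <= p v].
Proof.
move=> sp.
pose Q := {q | sublinear q /\ forall v, bounded_fct v -> q v <= p v}.
have p0 : Q by exists p.
pose below (q q' : Q) := `[< forall v, bounded_fct v -> sval q' v <= sval q v >].
have [||A tA|q qmin] := @ZL_preorder Q p0 below.
- by move=> q; apply/asboolP.
- move=> r s t /asboolP rs /asboolP st; apply/asboolP => v bv.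
  exact: le_trans (st _ bv) (rs _ bv).
- have [[q0 Aq0]|A0] := pselect (A !=set0); last first.
    by exists p0 => q Aq; case: A0; exists q.
  pose B v := [set sval q v | q in A].
  pose i v := inf (B v).
  have hB v : bounded_fct v -> has_inf (B v).
    move=> bv; split; first by exists (sval q0 v), q0.
    exists (- p (fun x => -1 * v x)) => _ [q _ <-].
    apply: (le_trans _ (sublinear_geN (svalP q).1 bv)); rewrite lerN2.
    by apply: (svalP q).2; exact: bounded_fctZ.
  have ile v q : bounded_fct v -> A q -> i v <= sval q v.
    by move=> bv Aq; apply: ge_inf; [exact: (hB _ bv).2|exists q].
  have lei v c : bounded_fct v -> (forall q, A q -> c <= sval q v) -> c <= i v.
    move=> bv cq; apply: lb_le_inf; first exact: (hB _ bv).1.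
    by move=> _ [q Aq <-]; exact: cq.
  have si : sublinear i.
    split=> [v w bv bw|a v a0 bv].
      rewrite -lerBlDr; apply: (lei) => // q1 A1; rewrite lerBlDr.
      rewrite -lerBlDl; apply: (lei) => // q2 A2; rewrite lerBlDl.
      have bvw := bounded_fctD bv bw.
      (* The smaller of the two chain elements bounds the infimum at [v \+ w], and its own
         subadditivity concludes. *)
      have [/asboolP h|/asboolP h] := tA _ _ A1 A2.
        apply: (le_trans (ile _ _ bvw A2)).
        apply: (le_trans ((svalP q2).1.1 _ _ bv bw)).
        by rewrite lerD2r h.
      apply: (le_trans (ile _ _ bvw A1)).
      apply: (le_trans ((svalP q1).1.1 _ _ bv bw)).
      by rewrite lerD2l h.
    have bav := bounded_fctZ a bv.
    move: a0 bav; rewrite le_eqVlt => /predU1P[<-|a0] bav.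
      apply/eqP; rewrite eq_le; apply/andP; split.
        apply: (le_trans (ile _ _ bav Aq0)).
        by rewrite ((svalP q0).1.2 0 v (lexx 0) bv) !mul0r.
      by apply: (lei) => // q Aq; rewrite ((svalP q).1.2 0 v (lexx 0) bv) !mul0r.
    apply/eqP; rewrite eq_le; apply/andP; split.
      rewrite -ler_pdivrMl//; apply: (lei) => // q Aq.
      rewrite ler_pdivrMl//; apply: (le_trans (ile _ _ bav Aq)).
      by rewrite (svalP q).1.2// ltW.
    by apply: (lei) => // q Aq; rewrite (svalP q).1.2 ?ler_pM2l ?ile// ltW.
  have iQ : sublinear i /\ forall v, bounded_fct v -> i v <= p v.
    by split=> // v bv; apply: (le_trans (ile _ _ bv Aq0)); exact: (svalP q0).2.
  exists (exist _ i iQ) => q Aq; apply/asboolP => v bv /=; exact: ile.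
exists (sval q).
have sq := (svalP q).1.
have addq : forall v w, bounded_fct v -> bounded_fct w ->
    sval q (v \+ w) = sval q v + sval q w.
  apply: minimal_sublinear_additive => // q' sq' q'q.
  have q'Q : sublinear q' /\ forall v, bounded_fct v -> q' v <= p v.
    by split=> // v bv; apply: (le_trans (q'q _ bv)); exact: (svalP q).2.
  have /qmin /asboolP := asboolT (q'q : forall v, bounded_fct v ->
    sval (exist _ q' q'Q : Q) v <= sval q v).
  exact.
have sqN v : bounded_fct v -> sval q (fun x => -1 * v x) = - sval q v.
  move=> bv; apply/eqP; rewrite -addr_eq0 addrC -addq//; last exact: bounded_fctZ.
  rewrite (_ : _ \+ _ = fun _ => 0) ?(sublinear0 sq)//.
  by apply/funext => x /=; rewrite mulN1r subrr.
split=> [//|a v bv|v bv]; last exact: (svalP q).2.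
have [a0|a0] := leP 0 a; first exact: sq.2.
rewrite (_ : (fun x => a * v x) = (fun x => -1 * ((- a) * v x))).
  rewrite sqN; last exact: bounded_fctZ.
  by rewrite sq.2// ?oppr_ge0 ?ltW// mulNr opprK.
by apply/funext => x; rewrite mulN1r mulNr opprK.
Qed.

(* [S v r] is read as the constraint [F v <= r] on the functional [F]. *)
Lemma hahn_banach_cone (S : (T -> R) -> R -> Prop) :
  (forall v w r s, S v r -> S w s -> S (v \+ w) (r + s)) ->
  (forall a v r, 0 < a -> S v r -> S (fun x => a * v x) (a * r)) ->
  (forall v, bounded_fct v -> exists r, S v r) ->
  (forall r, S (fun _ => 0) r -> 0 <= r) ->
  exists F : (T -> R) -> R,
  [/\ forall v w, bounded_fct v -> bounded_fct w -> F (v \+ w) = F v + F w,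
      forall (a : R) v, bounded_fct v -> F (fun x => a * v x) = a * F v &
      forall v r, bounded_fct v -> S v r -> F v <= r].
Proof.
move=> SD SZ Sex S0.
pose p v := inf (S v).
have hS v : bounded_fct v -> has_inf (S v).
  move=> bv; split; first exact: Sex.
  (* A constraint on [- v] added to one on [v] is a constraint on 0, so [S0] keeps the infimum
     finite. *)
  have [r Sr] := Sex _ (bounded_fctZ (-1) bv).
  exists (- r) => s Ss; rewrite lerNl -subr_ge0 opprK.
  apply: S0; rewrite (_ : (fun _ => 0) = (fun x => -1 * v x) \+ v); first exact: SD.
  by apply/funext => x /=; rewrite mulN1r addNr.
have ple v r : bounded_fct v -> S v r -> p v <= r.
  by move=> bv Sr; apply: ge_inf => //; exact: (hS _ bv).2.
have lep v c : bounded_fct v -> (forall r, S v r -> c <= r) -> c <= p v.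
  by move=> bv cr; apply: lb_le_inf => //; exact: (hS _ bv).1.
have p0 : p (fun _ => 0) = 0.
  have b0 := bounded_fct_cst T (0 : R).
  apply/eqP; rewrite eq_le (lep _ _ b0 S0) andbT.
  (* The cone need not contain the bound 0 for the zero function; scaling any bound [r] by
     [e / (r + 1)] gives bounds of at most [e]. *)
  have [r Sr] := Sex _ b0.
  apply/ler_addgt0Pl => e e0; rewrite addr0.
  have r1 : 0 < r + 1 by rewrite ltr_pwDr// S0.
  have a0 : 0 < e / (r + 1) by rewrite divr_gt0.
  have := SZ _ _ _ a0 Sr; rewrite (_ : (fun _ => _) = fun _ => 0); last first.
    by apply/funext => x; rewrite mulr0.
  move=> /(ple _ _ b0) /le_trans; apply.
  by rewrite -mulrA ger_pMr// mulrC ler_pdivrMr// mul1r lerDl.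
have sp : sublinear p.
  split=> [v w bv bw|a v].
    rewrite -lerBlDr; apply: (lep) => // r Sr; rewrite lerBlDr.
    rewrite -lerBlDl; apply: (lep) => // s Ss; rewrite lerBlDl.
    by apply: (ple); [exact: bounded_fctD|exact: SD].
  rewrite le_eqVlt => /predU1P[<- bv|a0 bv].
    by rewrite mul0r -[RHS]p0; congr p; apply/funext => x; rewrite mul0r.
  have bav := bounded_fctZ a bv.
  apply/eqP; rewrite eq_le; apply/andP; split.
    rewrite -ler_pdivrMl//; apply: (lep) => // r Sr.
    by rewrite ler_pdivrMl//; apply: (ple) => //; exact: SZ.
  apply: (lep) => // r Sr; rewrite -ler_pdivlMl//; apply: (ple) => //.
  have ia0 : 0 < a^-1 by rewrite invr_gt0.
  have := SZ _ _ _ ia0 Sr; congr S; apply/funext => x.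
  by rewrite mulrA mulVf ?mul1r// gt_eqF.
have [F [FD FZ Fp]] := exists_linear_below sp.
exists F; split=> // v r bv Sr; exact: le_trans (Fp _ bv) (ple _ _ bv Sr).
Qed.

End HahnBanach.

(** * Finitely supported probability measures *)

Section FiniteMeasure.
Variables (R : realType) (T : Type).
Implicit Types (L : seq (R * T)) (f g : T -> R).

(** A measure is a list of weighted points, repetitions allowed. Lists of arbitrary total mass occur
    as well, as elements of a cone in the separation argument. *)
Definition Ex L f : R := \sum_(x <- L) x.1 * f x.2.

Definition nneg_weights L : bool := all (fun x => 0 <= x.1) L.

Definition is_prob L : Prop := nneg_weights L /\ Ex L (fun _ => 1) = 1.

Lemma Ex_cons x L f : Ex (x :: L) f = x.1 * f x.2 + Ex L f.
Proof. by rewrite /Ex big_cons. Qed.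

Lemma ExD L f g : Ex L (fun x => f x + g x) = Ex L f + Ex L g.
Proof. by rewrite /Ex -big_split/=; apply: eq_bigr => x _; rewrite mulrDr. Qed.

Lemma ExZ L a f : Ex L (fun x => a * f x) = a * Ex L f.
Proof. by rewrite /Ex mulr_sumr; apply: eq_bigr => x _; rewrite mulrCA. Qed.

Lemma ExB L f g : Ex L (fun x => f x - g x) = Ex L f - Ex L g.
Proof.
rewrite -[in RHS]mulN1r -ExZ -ExD; congr Ex.
by apply/funext => x; rewrite mulN1r.
Qed.

Lemma Ex_cat L1 L2 f : Ex (L1 ++ L2) f = Ex L1 f + Ex L2 f.
Proof. by rewrite /Ex big_cat. Qed.

Lemma Ex_cst L a : Ex L (fun _ => a) = a * Ex L (fun _ => 1).
Proof. by rewrite -ExZ; congr Ex; apply/funext => x; rewrite mulr1. Qed.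

Lemma Ex_prob_cst L a : is_prob L -> Ex L (fun _ => a) = a.
Proof. by move=> [_ L1]; rewrite Ex_cst L1 mulr1. Qed.

Lemma ler_Ex L f g : nneg_weights L -> (forall x, f x <= g x) ->
  Ex L f <= Ex L g.
Proof.
move=> + fg; elim: L => [|x L IH]; first by rewrite /Ex !big_nil.
by move=> /= /andP[x0 L0]; rewrite !Ex_cons lerD ?IH// ler_wpM2l.
Qed.

Lemma Ex_ge0 L f : nneg_weights L -> (forall x, 0 <= f x) -> 0 <= Ex L f.
Proof.
by move=> L0 f0; have := ler_Ex L0 f0; rewrite Ex_cst mul0r.
Qed.

Lemma Ex_prob_le L f a : is_prob L -> (forall x, f x <= a) -> Ex L f <= a.
Proof.
by move=> Lp fa; rewrite -[leRHS](Ex_prob_cst a Lp); exact: ler_Ex Lp.1 fa.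
Qed.

Lemma Ex_prob_norm_le L f a : is_prob L -> (forall x, `|f x| <= a) ->
  `|Ex L f| <= a.
Proof.
move=> Lp fa; rewrite ler_norml; apply/andP; split.
  rewrite -[leLHS](Ex_prob_cst (- a) Lp); apply: ler_Ex Lp.1 _ => x.
  by have := fa x; rewrite ler_norml => /andP[].
by apply: Ex_prob_le Lp _ => x; exact: le_trans (ler_norm _) (fa x).
Qed.

Definition scale_weights (a : R) L := [seq (a * x.1, x.2) | x <- L].

Lemma Ex_scale a L f : Ex (scale_weights a L) f = a * Ex L f.
Proof.
by rewrite /Ex big_map mulr_sumr; apply: eq_bigr => x _; rewrite mulrA.
Qed.

Lemma nneg_weights_scale a L : 0 <= a -> nneg_weights L ->
  nneg_weights (scale_weights a L).
Proof.
move=> a0; elim: L => //= x L IH /andP[x0 L0].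
by rewrite mulr_ge0//=; exact: IH.
Qed.

(** The variance is at most the second moment about any constant, here the value of [f] at the first
    point of [L]; a probability is never the empty list. *)
Lemma variance_le L f c : is_prob L -> (forall x y, `|f x - f y| <= c) ->
  Ex L (fun x => f x ^+ 2) - Ex L f ^+ 2 <= c ^+ 2.
Proof.
case: L => [[_ /eqP]|[p t] L]; first by rewrite /Ex big_nil eq_sym oner_eq0.
set L' := _ :: L => Lp fc.
have : Ex L' (fun x => (f x - f t) ^+ 2) <= c ^+ 2.
  apply: Ex_prob_le Lp _ => x; rewrite -[leLHS]real_normK ?num_real//.
  by rewrite lerXn2r// nnegrE// (le_trans _ (fc x t)).
rewrite (_ : Ex L' (fun x => (f x - f t) ^+ 2) =
             Ex L' (fun x => f x ^+ 2) - 2 * f t * Ex L' f + f t ^+ 2).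
  have := sqr_ge0 (Ex L' f - f t); lra.
rewrite -ExZ -ExB -[in RHS](Ex_prob_cst (f t ^+ 2) Lp) -ExD; congr Ex.
by apply/funext => x; ring.
Qed.

End FiniteMeasure.

Lemma Ex_map (R : realType) (T U : Type) (h : T -> U) (L : seq (R * T)) f :
  Ex [seq (x.1, h x.2) | x <- L] f = Ex L (f \o h).
Proof. by rewrite /Ex big_map. Qed.

Lemma is_prob_map (R : realType) (T U : Type) (h : T -> U) (L : seq (R * T)) :
  is_prob L -> is_prob [seq (x.1, h x.2) | x <- L].
Proof.
move=> [L0 L1]; split; last by rewrite Ex_map.
by rewrite /nneg_weights all_map; exact: L0.
Qed.

Lemma Ex_exchange (R : realType) (T U : Type) (L : seq (R * T))
    (L' : seq (R * U)) (f : T -> U -> R) :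
  Ex L (fun x => Ex L' (f x)) = Ex L' (fun y => Ex L (f^~ y)).
Proof.
rewrite /Ex; under eq_bigr do rewrite mulr_sumr.
rewrite exchange_big/=; apply: eq_bigr => y _; rewrite mulr_sumr.
by apply: eq_bigr => x _; rewrite mulrCA.
Qed.

(** * Variance and translations under product measures *)

Section ProductMeasure.
Variables (R : realType) (T : Type).
Implicit Types (L : seq (R * T)) (h : nat -> T).

Definition scons (t : T) h : nat -> T :=
  fun k => if k is k'.+1 then h k' else t.

Definition upd h (k : nat) (t : T) : nat -> T :=
  fun i => if i == k then t else h i.

Lemma scons_upd t h k s : scons t (upd h k s) = upd (scons t h) k.+1 s.
Proof. by apply/funext => -[|i]. Qed.

Lemma upd_scons t h s : scons s h = upd (scons t h) 0 s.
Proof. by apply/funext => -[|i]. Qed.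

(** The product lives on infinite sequences, equal to [t0] from index [n] on, which avoids tuple
    types depending on [n]. *)
Fixpoint pow_prob (t0 : T) L (n : nat) : seq (R * (nat -> T)) :=
  if n is n'.+1 then
    [seq (x.1 * y.1, scons x.2 y.2) | x <- L, y <- pow_prob t0 L n']
  else [:: (1, fun _ => t0)].

Lemma Ex_pow0 t0 L f : Ex (pow_prob t0 L 0) f = f (fun _ => t0).
Proof. by rewrite /Ex/= big_seq1 mul1r. Qed.

Lemma Ex_powS t0 L n f : Ex (pow_prob t0 L n.+1) f =
  Ex L (fun t => Ex (pow_prob t0 L n) (fun h => f (scons t h))).
Proof.
rewrite /Ex/= big_allpairs_dep/=; apply: eq_bigr => x _; rewrite mulr_sumr.
by apply: eq_bigr => y _; rewrite mulrA.
Qed.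

Lemma is_prob_pow t0 L n : is_prob L -> is_prob (pow_prob t0 L n).
Proof.
move=> Lp; elim: n => [|n IH].
  by split; [rewrite /nneg_weights/= ler01|rewrite Ex_pow0].
split; last by rewrite Ex_powS !Ex_prob_cst.
rewrite /nneg_weights/=; case: Lp IH => + _ [+ _].
elim: L (pow_prob _ _ _) => //= x L IHL M /andP[x0 L0] M0.
rewrite all_cat IHL// andbT all_map; apply: sub_all M0 => y /= y0.
exact: mulr_ge0.
Qed.

(** Law of total variance, conditioning on the first coordinate: the conditional mean [m] oscillates
    by at most [c], and each conditional variance is bounded by induction. *)
Lemma variance_pow_le t0 L n (f : (nat -> T) -> R) c : is_prob L ->
  (forall h k s t, `|f (upd h k s) - f (upd h k t)| <= c) ->
  Ex (pow_prob t0 L n) (fun h => f h ^+ 2) - Ex (pow_prob t0 L n) f ^+ 2 <=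
  n%:R * c ^+ 2.
Proof.
move=> Lp; elim: n f => [|n IH] f fc; first by rewrite !Ex_pow0 subrr mul0r.
rewrite !Ex_powS.
set m := fun t => Ex (pow_prob t0 L n) (fun h => f (scons t h)).
have Pn := is_prob_pow t0 n Lp.
have mc s t : `|m s - m t| <= c.
  rewrite /m -ExB; apply: Ex_prob_norm_le Pn _ => h.
  by have := fc (scons t h) 0%N s t; rewrite -!upd_scons.
have step t : Ex (pow_prob t0 L n) (fun h => f (scons t h) ^+ 2) <=
    m t ^+ 2 + n%:R * c ^+ 2.
  rewrite -lerBlDl; apply: (IH (fun h => f (scons t h))) => h k s s'.
  by rewrite !scons_upd.
apply: (@le_trans _ _ (Ex L (fun t => m t ^+ 2 + n%:R * c ^+ 2) - Ex L m ^+ 2)).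
  by rewrite lerB//; exact: ler_Ex Lp.1 step.
rewrite ExD Ex_prob_cst// -natr1 mulrDl mul1r addrAC addrC lerD2l.
exact: variance_le.
Qed.

(* Coordinates are translated one at a time. *)
Lemma translate_pow_le t0 L n (tr : nat -> T -> T) (f : (nat -> T) -> R) e :
  is_prob L ->
  (forall h k i, (i < n)%N ->
     `|Ex L (fun t => f (upd h k (tr i t))) - Ex L (fun t => f (upd h k t))| <= e) ->
  `|Ex (pow_prob t0 L n) (fun h => f (fun k => if (k < n)%N then tr k (h k) else h k))
    - Ex (pow_prob t0 L n) f| <= n%:R * e.
Proof.
move=> Lp; elim: n tr f => [|n IH] tr f fe; first by rewrite !Ex_pow0 subrr mul0r normr0.
have Pn := is_prob_pow t0 n Lp.
rewrite !Ex_powS -natr1 mulrDl mul1r.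
set E := Ex (pow_prob t0 L n).
have -> : Ex L (fun t => E (fun h => f (fun k => if (k < n.+1)%N then
     tr k (scons t h k) else scons t h k))) =
   Ex L (fun t => E (fun h => f (scons (tr 0%N t)
      (fun k => if (k < n)%N then tr k.+1 (h k) else h k)))).
  congr Ex; apply/funext => t; congr Ex; apply/funext => h; congr f.
  by apply/funext => -[|k].
(* The intermediate term translates only the first coordinate: induction handles the others, and
   [fe] handles the first with the others frozen. *)
rewrite (le_trans (ler_distD (Ex L (fun t => E (fun h => f (scons (tr 0%N t) h)))) _ _))//.
rewrite lerD// -ExB.
  apply: Ex_prob_norm_le Lp _ => t.
  apply: (IH (fun k => tr k.+1) (fun h => f (scons (tr 0%N t) h))) => h k i ik.
  under eq_fun do rewrite scons_upd.
  under [in X in _ - X]eq_fun do rewrite scons_upd.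
  exact: fe.
rewrite ExB Ex_exchange [X in _ - X]Ex_exchange -ExB.
apply: Ex_prob_norm_le Pn _ => h.
have := fe (scons t0 h) 0%N 0%N (ltn0Sn _).
by under eq_fun do rewrite -upd_scons; under [in X in _ - X]eq_fun do rewrite -upd_scons.
Qed.

End ProductMeasure.

(** * Topological groups and invariant means *)

Section TopGroup.
Variables (G : topologicalType) (mul : G -> G -> G) (inv : G -> G) (one : G).
Hypothesis tg : is_topgroup mul inv one.

Lemma tg_mulA x y z : mul x (mul y z) = mul (mul x y) z.
Proof. by case: tg. Qed.
Lemma tg_mul1g x : mul one x = x.
Proof. by case: tg => _ /(_ x)[]. Qed.
Lemma tg_mulg1 x : mul x one = x.
Proof. by case: tg => _ /(_ x)[]. Qed.
Lemma tg_mulVg x : mul (inv x) x = one.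
Proof. by case: tg => _ _ /(_ x)[]. Qed.
Lemma tg_mulgV x : mul x (inv x) = one.
Proof. by case: tg => _ _ /(_ x)[]. Qed.
Lemma tg_mulKg x y : mul (inv x) (mul x y) = y.
Proof. by rewrite tg_mulA tg_mulVg tg_mul1g. Qed.
Lemma tg_mulKVg x y : mul x (mul (inv x) y) = y.
Proof. by rewrite tg_mulA tg_mulgV tg_mul1g. Qed.
Lemma tg_mulgK x y : mul (mul y x) (inv x) = y.
Proof. by rewrite -tg_mulA tg_mulgV tg_mulg1. Qed.
Lemma tg_mulgKV x y : mul (mul y (inv x)) x = y.
Proof. by rewrite -tg_mulA tg_mulVg tg_mulg1. Qed.
Lemma tg_mulI x : injective (mul x).
Proof. by move=> y z; rewrite -{2}(tg_mulKg x y) => ->; rewrite tg_mulKg. Qed.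
Lemma tg_invM x y : inv (mul x y) = mul (inv y) (inv x).
Proof.
by apply: (@tg_mulI (mul x y)); rewrite tg_mulgV -tg_mulA tg_mulKVg tg_mulgV.
Qed.
Lemma tg_inv1 : inv one = one.
Proof. by rewrite -[LHS]tg_mul1g tg_mulgV. Qed.
Lemma tg_invK x : inv (inv x) = x.
Proof. by apply: (@tg_mulI (inv x)); rewrite tg_mulgV tg_mulVg. Qed.
Lemma tg_divM x y z : mul (mul x z) (inv (mul y z)) = mul x (inv y).
Proof. by rewrite tg_invM tg_mulA tg_mulgK. Qed.

Lemma tg_cvgM (I : Type) (F : set_system I) (FF : Filter F) (f h : I -> G) a b :
  f @ F --> a -> h @ F --> b -> (fun x => mul (f x) (h x)) @ F --> mul a b.
Proof.
move=> fa hb; apply: continuous2_cvg fa hb.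
by case: tg => _ _ _ cmul _; exact: (cmul (_, _)).
Qed.

Lemma tg_cvgV (I : Type) (F : set_system I) (FF : Filter F) (f : I -> G) a :
  f @ F --> a -> (fun x => inv (f x)) @ F --> inv a.
Proof.
move=> fa; apply: (@continuous_cvg _ _ _ F _ f inv a _ fa).
by case: tg => _ _ _ _ cinv; exact: cinv.
Qed.

Lemma tg_nbhs_mul U : nbhs one U -> exists V, nbhs one V /\
  forall a b, V a -> V b -> U (mul a b).
Proof.
move=> U1; have : (fun p : G * G => mul p.1 p.2) @ nbhs (one, one) --> mul one one.
  by case: tg => _ _ _ cmul _; exact: (cmul (_, _)).
rewrite tg_mul1g => /(_ _ U1)[[A B] /= [A1 B1] AB].
exists (A `&` B); split; first exact: filterI.
by move=> a b [Aa _] [_ Bb]; exact: (AB (a, b)).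
Qed.

Lemma tg_nbhs_conj U g : nbhs one U ->
  nbhs one [set v | U (mul (mul g v) (inv g))].
Proof.
move=> U1.
have : (fun v => mul (mul g v) (inv g)) @ one --> mul (mul g one) (inv g).
  by apply: tg_cvgM; [apply: tg_cvgM; [exact: cvg_cst|exact: cvg_id]|exact: cvg_cst].
by rewrite tg_mulg1 tg_mulgV; exact.
Qed.

Lemma tg_nbhs_inv U : nbhs one U -> nbhs one [set v | U (inv v)].
Proof.
move=> U1; have : inv @ one --> inv one by apply: tg_cvgV; exact: cvg_id.
by rewrite tg_inv1; exact.
Qed.

Variable R : realType.
Implicit Types f : G -> R.
Local Notation RUC := (@RUCb R G mul inv one).

Lemma RUCb_cst (a : R) : RUC (fun _ => a).
Proof.
split; first exact: bounded_fct_cst.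
move=> e e0; exists setT; split; first exact: filterT.
by move=> x y _; rewrite subrr normr0.
Qed.

Lemma RUCbD f h : RUC f -> RUC h -> RUC (f \+ h).
Proof.
move=> [bf cf] [bh ch]; split; first exact: bounded_fctD.
move=> e e0; have e2 : 0 < e / 2 by rewrite divr_gt0.
have [U [U1 Uf]] := cf _ e2; have [V [V1 Vh]] := ch _ e2.
exists (U `&` V); split; first exact: filterI.
move=> x y [Uxy Vxy] /=; rewrite opprD addrACA (le_lt_trans (ler_normD _ _))//.
by rewrite (splitr e) ltrD// ?Uf ?Vh.
Qed.

Lemma RUCbZ (a : R) f : RUC f -> RUC (fun x => a * f x).
Proof.
move=> [bf cf]; split; first exact: bounded_fctZ.
move=> e e0; have a1 : 0 < `|a| + 1 by rewrite ltr_wpDl.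
have [|U [U1 Uf]] := cf (e / (`|a| + 1)); first by rewrite divr_gt0.
exists U; split=> // x y Uxy.
rewrite -mulrBr normrM (@le_lt_trans _ _ ((`|a| + 1) * `|f x - f y|))//.
  by rewrite ler_wpM2r// lerDl.
by rewrite -ltr_pdivlMl// mulrC Uf.
Qed.

(** Left translation conjugates the entourage by [g], so the modulus of continuity depends on
    [g]. *)
Lemma RUCb_translate g f : RUC f -> RUC (fun x => f (mul g x)).
Proof.
move=> [[M fM] cf]; split; first by exists M.
move=> e e0; have [U [U1 Uf]] := cf _ e0.
exists [set v | U (mul (mul g v) (inv g))]; split; first exact: tg_nbhs_conj.
move=> x y /= Uxy; apply: Uf; rewrite tg_invM tg_mulA.
by rewrite -[mul (mul g x) (inv y)]tg_mulA.
Qed.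

End TopGroup.

(** [P] is the domain of additivity: RUC functions for a mean, bounded functions for a Hahn-Banach
    functional. *)
Lemma additive_sum (R : realType) (T : Type) (P : (T -> R) -> Prop)
    (F : (T -> R) -> R) (I : Type) (r : seq I) (v : I -> T -> R) :
  P (fun _ => 0) -> (forall f g, P f -> P g -> P (f \+ g)) ->
  (forall f g, P f -> P g -> F (f \+ g) = F f + F g) ->
  (forall i, P (v i)) ->
  P (fun x => \sum_(i <- r) v i x) /\
  F (fun x => \sum_(i <- r) v i x) = \sum_(i <- r) F (v i).
Proof.
move=> P0 PD FD Pv; elim: r => [|i r [IHP IHF]].
  have -> : (fun x => \sum_(i <- [::]) v i x) = fun _ => 0.
    by apply/funext => x; rewrite big_nil.
  split=> //; rewrite big_nil; apply: (@addrI _ (F (fun _ => 0))).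
  rewrite addr0 -FD//; congr F; apply/funext => x /=; exact: addr0.
have -> : (fun x => \sum_(j <- i :: r) v j x) =
          v i \+ (fun x => \sum_(j <- r) v j x).
  by apply/funext => x; rewrite big_cons.
by split; [exact: PD|rewrite big_cons FD// IHF].
Qed.

(** * Almost invariant finitely supported measures *)

Section UniformAmenability.
Variables (R : realType) (G : topologicalType).
Variables (mul : G -> G -> G) (inv : G -> G) (one : G).
Hypothesis tg : is_topgroup mul inv one.

(* If no finitely supported probability works, Hahn-Banach separation in
   l^oo(H x gs) yields right uniformly continuous functions f_g such that
   sum_g (f_g (g s) - f_g s) >= e for all s, against the invariant mean. *)
Lemma uniform_amenability (H : set (G -> R)) (B e : R) (gs : seq G) :
  amenable R mul inv one ->
  (forall u x, H u -> `|u x| <= B) ->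
  (forall eta : R, 0 < eta -> exists V, nbhs one V /\
     forall u x y, H u -> V (mul x (inv y)) -> `|u x - u y| <= eta) ->
  0 < e ->
  exists2 L : seq (R * G), is_prob L &
    forall u g, H u -> g \in gs ->
      `|Ex L (fun s => u (mul g s)) - Ex L u| <= e.
Proof.
move=> [mu [muD muZ mu_ge0 mu1 muI]] HB Hc e0; apply: contrapT => noL.
have {}noL L : is_prob L -> exists u g, [/\ H u, g \in gs &
    e < `|Ex L (fun s => u (mul g s) - u s)|].
  move=> Lp; apply: contrapT => nug; apply: noL; exists L => // u g Hu ggs.
  by rewrite leNgt; apply/negP => lte; apply: nug; exists u, g; rewrite ExB.
pose T := ((G -> R) * G)%type.
(* Two kinds of constraints generate this cone: [F v <= b] when [|v| <= b] on [H x gs], and [F >= e]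
   on each function [(u, g) |-> u (mul g s) - u s]. [L] lists the multiples of the second kind that
   are used. *)
pose S (v : T -> R) r := exists L b, [/\ nneg_weights L, 0 <= b,
  forall u g, H u -> g \in gs ->
    `|v (u, g) + Ex L (fun s => u (mul g s) - u s)| <= b &
  r = b - e * Ex L (fun _ => 1)].
have [||||F [FD FZ FS]] := @hahn_banach_cone R T S.
- move=> v w _ _ [L [b [L0 b0 Lb ->]]] [L' [b' [L'0 b'0 Lb' ->]]].
  exists (L ++ L'), (b + b'); split.
  + by rewrite /nneg_weights all_cat; apply/andP.
  + exact: addr_ge0.
  + move=> u g Hu ggs; rewrite Ex_cat /= addrACA (le_trans (ler_normD _ _))//.
    by rewrite lerD ?Lb ?Lb'.
  + by rewrite Ex_cat; ring.
- move=> a v _ a0 [L [b [L0 b0 Lb ->]]].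
  exists (scale_weights a L), (a * b); split.
  + by apply: nneg_weights_scale => //; exact: ltW.
  + by rewrite mulr_ge0// ltW.
  + move=> u g Hu ggs; rewrite Ex_scale -mulrDr normrM gtr0_norm//.
    by rewrite ler_pM2l// Lb.
  + by rewrite Ex_scale; ring.
- move=> v [M vM]; exists (M - e * Ex [::] (fun _ : G => 1)), [::], M.
  split=> //; first exact: le_trans (normr_ge0 _) (vM (fun _ => 0, one)).
  by move=> u g _ _; rewrite /Ex big_nil addr0.
- move=> _ [L [b [L0 b0 Lb ->]]].
  have : 0 <= Ex L (fun _ => 1) by exact: Ex_ge0.
  rewrite le_eqVlt => /predU1P[<-|m0]; first by rewrite mulr0 subr0.
  (* Consistency of the constraints: if [b] were below [e] times the mass, the normalised [L] would
     be almost invariant. *)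
  have [|u [g [Hu ggs]]] := noL (scale_weights (Ex L (fun _ => 1))^-1 L).
    split; first by apply: nneg_weights_scale => //; rewrite invr_ge0 ltW.
    by rewrite Ex_scale mulVf// gt_eqF.
  rewrite Ex_scale normrM gtr0_norm ?invr_gt0// -ltr_pdivrMl ?invr_gt0// invrK.
  move=> lte; rewrite subr_ge0 mulrC ltW// (lt_le_trans lte)//.
  by have := Lb u g Hu ggs; rewrite add0r.
have F_le v b : bounded_fct v -> 0 <= b ->
    (forall u g, H u -> g \in gs -> `|v (u, g)| <= b) -> F v <= b.
  move=> bv b0 vb; apply: FS => //; exists [::], b; split=> //.
    by move=> u g Hu ggs; rewrite /Ex big_nil addr0 vb.
  by rewrite /Ex big_nil mulr0 subr0.
have F_norm_le v b : bounded_fct v -> 0 <= b ->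
    (forall u g, H u -> g \in gs -> `|v (u, g)| <= b) -> `|F v| <= b.
  move=> bv b0 vb; rewrite ler_norml F_le// andbT lerNl -mulN1r -FZ//.
  apply: F_le => //; first exact: bounded_fctZ.
  by move=> u g Hu ggs; rewrite mulN1r normrN vb.
(* Evaluation at [s] on the slice [g], cut off outside [H], where nothing bounds it. Applying [F]
   yields a function of [s] that inherits the bound and the modulus common to [H]. *)
pose vb g s : T -> R := fun p => if `[< H p.1 >] && (p.2 == g) then p.1 s else 0.
have vbB g s p : `|vb g s p| <= `|B|.
  rewrite /vb; case: ifPn => [/andP[/asboolP Hp _]|_]; last by rewrite normr0.
  by rewrite (le_trans (HB _ _ Hp))// ler_norm.
have bvb g s : bounded_fct (vb g s) by exists `|B|.
pose f g s := F (vb g s).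
have FB v w : bounded_fct v -> bounded_fct w ->
    F (fun p => v p - w p) = F v - F w.
  move=> bv bw; rewrite -[X in _ + X]mulN1r -FZ// -FD//; last exact: bounded_fctZ.
  by congr F; apply/funext => p /=; rewrite mulN1r.
have bB v w : bounded_fct v -> bounded_fct w -> bounded_fct (fun p : T => v p - w p).
  move=> bv bw; rewrite (_ : (fun _ => _) = v \+ (fun p => -1 * w p)).
    by apply: bounded_fctD => //; exact: bounded_fctZ.
  by apply/funext => p /=; rewrite mulN1r.
have fRUC g : RUCb mul inv one (f g).
  split; first by exists `|B| => s; apply: F_norm_le.
  move=> eta eta0; have [|V [V1 VH]] := Hc (eta / 2); first by rewrite divr_gt0.
  exists V; split=> // x y Vxy.
  apply: (@le_lt_trans _ _ (eta / 2)); last by rewrite ltr_pdivrMr// ltr_pMr// ltr1n.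
  rewrite /f -FB//; apply: F_norm_le; [exact: bB|by rewrite divr_ge0// ltW|].
  move=> u g' Hu _; rewrite /vb/=; case: ifP => _; first exact: VH.
  by rewrite subrr normr0 divr_ge0// ltW.
pose w g s := f g (mul g s) - f g s.
have wRUC g : RUCb mul inv one (w g).
  rewrite (_ : w g = (fun s => f g (mul g s)) \+ (fun s => -1 * f g s)).
    by apply: RUCbD; [exact: (RUCb_translate tg)|exact: RUCbZ].
  by apply/funext => s; rewrite /w/= mulN1r.
have muw g : mu (w g) = 0.
  rewrite (_ : w g = (fun s => f g (mul g s)) \+ (fun s => -1 * f g s)).
    rewrite muD; [|exact: (RUCb_translate tg)|exact: RUCbZ].
    by rewrite muZ// muI// mulN1r subrr.
  by apply/funext => s; rewrite /w/= mulN1r.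
have [sRUC mus] := additive_sum (undup gs) (RUCb_cst mul inv one 0)
  (@RUCbD _ mul inv one R) muD wRUC.
(* At a pair [(u, g)] only the slice [g] contributes, and only once thanks to [undup]. The sum over
   slices is thus [u (mul g s) - u s], and the constraint with the Dirac mass at [s] and [b = 0]
   applies. *)
have e_le s : e <= \sum_(g <- undup gs) w g s.
  pose D g : T -> R := fun p => vb g (mul g s) p - vb g s p.
  have bD g : bounded_fct (D g) by exact: bB.
  have [bs Fs] := additive_sum (undup gs) (bounded_fct_cst T 0)
    (@bounded_fctD R T) FD bD.
  have -> : \sum_(g <- undup gs) w g s = F (fun p => \sum_(g <- undup gs) D g p).
    by rewrite Fs; apply: eq_bigr => g _; rewrite /D FB.
  rewrite -lerN2 -mulN1r -FZ//; apply: FS; first exact: bounded_fctZ.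
  exists [:: (1, s)], 0; split=> //; first by rewrite /nneg_weights/= ler01.
    move=> u g Hu ggs; rewrite Ex_cons /Ex big_nil addr0/= mul1r mulN1r.
    rewrite (bigD1_seq g) ?mem_undup ?undup_uniq//= big1 ?addr0; last first.
      by move=> g' /negbTE g'g; rewrite /D /vb /= eq_sym g'g andbF subrr.
    by rewrite /D /vb /= eqxx andbT asboolT// addNr normr0.
  by rewrite Ex_cons /Ex big_nil addr0 !mulr1 sub0r.
have eRUC : RUCb mul inv one (fun _ => - e * 1) by exact: RUCb_cst.
have : 0 <= mu ((fun x => \sum_(g <- undup gs) w g x) \+ (fun _ => - e * 1)).
  apply: mu_ge0; first exact: RUCbD.
  by move=> x /=; rewrite mulr1 subr_ge0.
rewrite muD// mus big1 => [|g _]; last exact: muw.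
rewrite muZ ?mu1; last exact: RUCb_cst.
by rewrite add0r mulr1 oppr_ge0 leNgt e0.
Qed.

End UniformAmenability.

(** * The topological group L^0(G) *)

Section Defect.
Variable R : realType.
Local Notation lambda := (@lebesgue_measure R).
Local Notation I01 := (`[(0:R), 1]%classic : set R).
Implicit Types P Q S : R -> Prop.

(** The outer measure of the set where [P] fails. The rules below use monotonicity and
    subadditivity, so [P] may be any predicate. *)
Definition defect P : \bar R := lambda [set x | I01 x /\ ~ P x].

Lemma le_lebesgue_outer (A B : set R) : A `<=` B -> (lambda A <= lambda B)%E.
Proof. exact: (@le_outer_measure _ _ ((wlength idfun)^*)%mu). Qed.

Lemma lebesgue_outerU (A B : set R) :
  (lambda (A `|` B) <= lambda A + lambda B)%E.
Proof. exact: (@outer_measureU2 _ _ ((wlength idfun)^*)%mu). Qed.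

Lemma lebesgue_outer_ge0 (A : set R) : (0 <= lambda A)%E.
Proof. exact: (@outer_measure_ge0 _ _ ((wlength idfun)^*)%mu). Qed.

Lemma defect_ge0 P : (0 <= defect P)%E.
Proof. exact: lebesgue_outer_ge0. Qed.

Lemma defect_fin_num P : defect P \is a fin_num.
Proof.
rewrite ge0_fin_numE ?defect_ge0//; apply: (@le_lt_trans _ _ (lambda I01)).
  by apply: le_lebesgue_outer => x [].
by rewrite lebesgue_measure_itv/= lte_fin ltr01 ltry.
Qed.

Lemma defect_le P Q : (forall x, I01 x -> P x -> Q x) -> (defect Q <= defect P)%E.
Proof.
move=> PQ; apply: le_lebesgue_outer => x [x01 nQ]; split=> // Px.
exact/nQ/PQ.
Qed.

Lemma defect_and P Q S : (forall x, I01 x -> P x -> Q x -> S x) ->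
  (defect S <= defect P + defect Q)%E.
Proof.
move=> PQS; apply: le_trans (lebesgue_outerU _ _).
apply: le_lebesgue_outer => x [x01 nS].
have [Px|nP] := pselect (P x); last by left.
by right; split=> // Qx; exact/nS/PQS.
Qed.

Lemma defect_and0 P Q S : (forall x, I01 x -> P x -> Q x -> S x) ->
  defect P = 0%E -> (defect S <= defect Q)%E.
Proof. by move=> /defect_and + P0; rewrite P0 add0e. Qed.

Lemma defect_true P : (forall x, I01 x -> P x) -> defect P = 0%E.
Proof.
move=> PT; rewrite /defect (_ : [set _ | _] = set0) ?measure0//.
by apply/seteqP; split=> x // [x01]; apply; exact: PT.
Qed.

Lemma defect0 P : (defect P <= 0)%E -> defect P = 0%E.
Proof. by move=> P0; apply/eqP; rewrite eq_le P0 defect_ge0. Qed.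

Lemma defect_eq P Q : defect (fun x => P x <-> Q x) = 0%E -> defect P = defect Q.
Proof.
move=> PQ; apply/eqP; rewrite eq_le; apply/andP; split.
  by apply: defect_and0 PQ => x _ [_ +] Qx; exact.
by apply: defect_and0 PQ => x _ [+ _] Qx; exact.
Qed.

End Defect.

Section L0Basics.
Variables (R : realType) (G : topologicalType).
Implicit Types f g h : R -> G.
Local Notation SM := (@strongly_measurable R G).

Lemma L0ae_defect f g : ae_eq f g = (defect (fun x => f x = g x) = 0%E).
Proof. by []. Qed.

Lemma L0ae_refl f : ae_eq f f.
Proof. by rewrite L0ae_defect; exact: defect_true. Qed.

Lemma L0ae_sym f g : ae_eq f g -> ae_eq g f.
Proof.
by rewrite !L0ae_defect => fg; apply: defect0; rewrite -fg; apply: defect_le.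
Qed.

Lemma L0ae_trans f g h : ae_eq f g -> ae_eq g h -> ae_eq f h.
Proof.
rewrite !L0ae_defect => fg gh; apply: defect0; rewrite -gh.
by apply: defect_and0 fg => x _ ->.
Qed.

Lemma L0ae_map2 (op : G -> G -> G) f f' g g' : ae_eq f f' -> ae_eq g g' ->
  ae_eq (fun x => op (f x) (g x)) (fun x => op (f' x) (g' x)).
Proof.
rewrite !L0ae_defect => ff' gg'; apply: defect0; rewrite -gg'.
by apply: defect_and0 ff' => x _ -> ->.
Qed.

Lemma L0ae_map (op : G -> G) f g : ae_eq f g ->
  ae_eq (fun x => op (f x)) (fun x => op (g x)).
Proof. by move=> fg; exact: (L0ae_map2 (fun a _ => op a) fg fg). Qed.

Lemma L0class_eq f g : ae_eq f g -> L0class f = L0class g.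
Proof.
move=> fg; apply/seteqP; split=> h [hm fh]; split=> //.
  exact: L0ae_trans (L0ae_sym fg) fh.
exact: L0ae_trans fg fh.
Qed.

Lemma L0rep_sm (C : L0car R G) : SM (L0rep C).
Proof. by rewrite /L0rep; case: cid => f []. Qed.

Lemma L0repE (C : L0car R G) : sval C = L0class (L0rep C).
Proof. by rewrite /L0rep; case: cid => f []. Qed.

Lemma L0_eq (C D : L0car R G) : ae_eq (L0rep C) (L0rep D) -> C = D.
Proof.
move=> /L0class_eq; rewrite -!L0repE; case: C D => [C Cp] [D Dp] /= CD.
by move: Cp Dp; rewrite CD => Cp Dp; congr exist; exact: Prop_irrelevance.
Qed.

Lemma L0rep_of (one : G) f : SM f -> ae_eq (L0rep (L0of one f)) f.
Proof.
move=> fm.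
have : sval (L0of one f) = L0class f.
  by rewrite /L0of; case: pselect => //= -[]; exists f.
rewrite L0repE => e; have : L0class f f by split=> //; exact: L0ae_refl.
by rewrite -e => -[].
Qed.

Lemma L0rep_one (one : G) : ae_eq (L0rep (L0one R one)) (fun _ => one).
Proof.
have e := L0repE (L0one R one).
have : L0class (fun _ : R => one) (fun _ => one).
  by split; [exact: strongly_measurable_cst|exact: L0ae_refl].
by rewrite [L0class _](e : _ = _) => -[].
Qed.

End L0Basics.

Section L0Group.
Variables (R : realType) (G : topologicalType).
Variables (mul : G -> G -> G) (inv : G -> G) (one : G).
Hypothesis tg : is_topgroup mul inv one.
Implicit Types f g h : R -> G.
Local Notation SM := (@strongly_measurable R G).
Local Notation H := (@L0 R G mul one).
Local Notation hmul := (@L0m R G mul one).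
Local Notation hinv := (@L0i R G mul inv one).
Local Notation hone := (@L0e R G mul one).
Local Notation rep := (@L0rep R G).

Lemma strongly_measurable_mul f g : SM f -> SM g ->
  SM (fun x => mul (f x) (g x)).
Proof.
move=> fm gm e e0; have e2 : 0 < e / 2 by rewrite divr_gt0.
have [A [Ac A01 Ae Af]] := fm _ e2; have [B [Bc B01 Be Bg]] := gm _ e2.
exists (A `&` B); split.
- exact: closedI.
- by move=> x [/A01].
- apply: (@le_trans _ _ (defect A + defect B)%E).
    by apply: defect_and => x _ Ax Bx; split.
  by rewrite [e in leRHS](splitr e) EFinD; exact: leeD.
- have Af' : {within A `&` B, continuous f}.
    by apply: continuous_subspaceW Af; exact: subIsetl.
  have Bg' : {within A `&` B, continuous g}.
    by apply: continuous_subspaceW Bg; exact: subIsetr.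
  by move=> x; apply: (tg_cvgM tg); [exact: Af'|exact: Bg'].
Qed.

Lemma strongly_measurable_inv f : SM f -> SM (fun x => inv (f x)).
Proof.
move=> fm e /fm[A [Ac A01 Ae Af]]; exists A; split=> // x.
by apply: (tg_cvgV tg); exact: Af.
Qed.

Lemma L0rep_mul (C D : H) :
  ae_eq (rep (hmul C D)) (fun x => mul (rep C x) (rep D x)).
Proof. by apply: L0rep_of; apply: strongly_measurable_mul; exact: L0rep_sm. Qed.

Lemma L0rep_inv (C : H) : ae_eq (rep (hinv C)) (fun x => inv (rep C x)).
Proof. by apply: L0rep_of; apply: strongly_measurable_inv; exact: L0rep_sm. Qed.

Lemma L0mulA (C D E : H) : hmul C (hmul D E) = hmul (hmul C D) E.
Proof.
apply: L0_eq; apply: L0ae_trans (L0rep_mul _ _) _.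
apply: L0ae_trans (L0ae_map2 mul (L0ae_refl _) (L0rep_mul _ _)) _.
apply: L0ae_sym; apply: L0ae_trans (L0rep_mul _ _) _.
apply: L0ae_trans (L0ae_map2 mul (L0rep_mul _ _) (L0ae_refl _)) _.
rewrite (_ : (fun x => mul (mul _ _) _) =
  (fun x => mul (rep C x) (mul (rep D x) (rep E x)))); first exact: L0ae_refl.
by apply/funext => x; rewrite (tg_mulA tg).
Qed.

Lemma L0mul1g (C : H) : hmul hone C = C.
Proof.
apply: L0_eq; apply: L0ae_trans (L0rep_mul _ _) _.
apply: L0ae_trans (L0ae_map2 mul (L0rep_one _ _) (L0ae_refl _)) _.
rewrite (_ : (fun x => mul one _) = rep C); first exact: L0ae_refl.
by apply/funext => x; rewrite (tg_mul1g tg).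
Qed.

Lemma L0mulg1 (C : H) : hmul C hone = C.
Proof.
apply: L0_eq; apply: L0ae_trans (L0rep_mul _ _) _.
apply: L0ae_trans (L0ae_map2 mul (L0ae_refl _) (L0rep_one _ _)) _.
rewrite (_ : (fun x => mul _ one) = rep C); first exact: L0ae_refl.
by apply/funext => x; rewrite (tg_mulg1 tg).
Qed.

Lemma L0mulVg (C : H) : hmul (hinv C) C = hone.
Proof.
apply: L0_eq; apply: L0ae_trans (L0rep_mul _ _) _.
apply: L0ae_trans (L0ae_map2 mul (L0rep_inv _) (L0ae_refl _)) _.
rewrite (_ : (fun x => mul _ _) = fun _ => one).
  by apply: L0ae_sym; exact: L0rep_one.
by apply/funext => x; rewrite (tg_mulVg tg).
Qed.

Lemma L0mulgV (C : H) : hmul C (hinv C) = hone.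
Proof.
apply: L0_eq; apply: L0ae_trans (L0rep_mul _ _) _.
apply: L0ae_trans (L0ae_map2 mul (L0ae_refl _) (L0rep_inv _)) _.
rewrite (_ : (fun x => mul _ _) = fun _ => one).
  by apply: L0ae_sym; exact: L0rep_one.
by apply/funext => x; rewrite (tg_mulgV tg).
Qed.

Lemma L0N_defect (U : set G) (e : R) (C : H) f : ae_eq (rep C) f ->
  L0N U e C = (defect (fun x => U (f x)) < e%:E)%E.
Proof.
move=> Cf; rewrite /L0N/= -/(defect (fun x => U (rep C x))).
congr (_ < _)%E; apply: defect_eq; apply: defect0.
by move: Cf; rewrite L0ae_defect => <-; apply: defect_le => x _ ->.
Qed.

Lemma L0N_one (U : set G) (e : R) : U one -> 0 < e -> L0N U e hone.
Proof.
move=> U1 e0; rewrite (@L0N_defect _ _ _ (fun _ => one)); last exact: L0rep_one.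
by rewrite defect_true.
Qed.

Lemma L0N_mul (U V W : set G) (d e : R) (C D : H) :
  (forall a b, V a -> W b -> U (mul a b)) ->
  L0N V d C -> L0N W e D -> L0N U (d + e) (hmul C D).
Proof.
move=> VWU VC WD; rewrite (L0N_defect _ _ (L0rep_mul C D)) EFinD.
apply: le_lt_trans (lteD VC WD).
by apply: defect_and => x _; exact: VWU.
Qed.

Lemma L0N_le (U V : set G) (d e : R) (C : H) : V `<=` U -> d <= e ->
  L0N V d C -> L0N U e C.
Proof.
move=> VU de VC; apply: (@lt_le_trans _ _ d%:E); last by rewrite lee_fin.
by apply: le_lt_trans VC; apply: defect_le => x _; exact: VU.
Qed.

Definition L0small (A : set H) : Prop := exists (U : set G) (e : R),
  [/\ open U, U one, 0 < e & forall D, L0N U e D -> A D].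

(** The topology is declared by a subbase, so stability under finite intersections is what
    identifies its open sets with the [L0open] ones. *)
Lemma L0open_finI (A : set (L0car R G)) :
  finI_from (@L0open R G mul one) id A -> @L0open R G mul one A.
Proof.
move=> [F FD <-] C FC.
have : forall i, i \in finmap.enum_fset F -> @L0open R G mul one i /\ i C.
  by move=> i iF; split; [exact/set_mem/FD|exact: FC].
suff h (s : seq (set (L0car R G))) :
  (forall i, i \in s -> @L0open R G mul one i /\ i C) ->
  exists (U : set G) (e : R), [/\ open U, U one, 0 < e &
    forall D, L0N U e D -> forall i, i \in s -> i (L0mul mul one C D)].
  by move=> /h[U [e [Uo U1 e0 UF]]]; exists U, e; split=> // D /UF Ds i; exact: Ds.
elim: s => [_|i s IH is_].
  by exists setT, 1; split=> //; exact: openT.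
have [j js|U [e [Uo U1 e0 Us]]] := IH; first by apply: is_; rewrite inE js orbT.
have [io iC] := is_ i (mem_head _ _).
have [V [d [Vo V1 d0 Vi]]] := io _ iC.
exists (U `&` V), (Num.min e d); split; [exact: openI|by []|by rewrite lt_min e0|].
move=> E UVE j /=; rewrite inE => /predU1P[->|js].
  by apply: Vi; apply: L0N_le UVE => [x []//|]; rewrite ge_min lexx orbT.
by apply: Us js; apply: L0N_le UVE => [x []//|]; rewrite ge_min lexx.
Qed.

Lemma L0openE (A : set H) : open A <-> @L0open R G mul one A.
Proof.
split=> [[D Dsub <-] C [B DB BC]|Aop]; last first.
  exists [set A]; last by rewrite bigcup_set1.
  by move=> _ ->; exact: (@finI_from1 _ _ (@L0open R G mul one) id).
have [U [e [Uo U1 e0 UB]]] := L0open_finI (Dsub _ DB) BC.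
by exists U, e; split=> // E UE; exists B => //; exact: UB.
Qed.

Lemma L0_nbhsP (C : H) (A : set H) :
  nbhs C A <-> L0small [set D | A (hmul C D)].
Proof.
rewrite nbhsE; split=> [[B [Bo BC] BA]|[U [e [Uo U1 e0 UA]]]].
  have [U [e [Uo U1 e0 UB]]] := (L0openE B).1 Bo _ BC.
  by exists U, e; split=> // D /UB /BA.
(* The candidate for the interior of [A]. It is open because a product of two elements of [W] lies
   in [V] and the measures of the exceptional sets add. *)
exists [set D | L0small [set E | A (hmul D E)]].
  split; last by exists U, e.
  apply/L0openE => D [V [d [Vo V1 d0 VA]]].
  have [W [W1 WV]] := tg_nbhs_mul tg (open_nbhs_nbhs (conj Vo V1)).
  have d2 : 0 < d / 2 by rewrite divr_gt0.
  exists W°, (d / 2); split=> //; first exact: open_interior.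
  move=> E WE; exists W°, (d / 2); split=> //; first exact: open_interior.
  move=> E' WE' /=; rewrite -L0mulA; apply: VA; rewrite (splitr d).
  by apply: L0N_mul WE WE' => a b /interior_subset Wa /interior_subset Wb; exact: WV.
move=> D [V [d [_ V1 d0 VA]]] /=.
by rewrite -(L0mulg1 D); apply: VA; exact: L0N_one.
Qed.

Lemma L0_nbhs1P (A : set H) : nbhs hone A <-> L0small A.
Proof.
rewrite L0_nbhsP /L0small; split=> -[U [e [Uo U1 e0 UA]]]; exists U, e;
  split=> // D /UA /=; by rewrite L0mul1g.
Qed.

(* A strongly measurable map has compact image off a small set. *)
Lemma L0small_conj (D : H) (A : set H) : L0small A ->
  L0small [set E | A (hmul (hmul (hinv D) E) D)].
Proof.
move=> [U [e [Uo U1 e0 UA]]].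
have e2 : 0 < e / 2 by rewrite divr_gt0.
have [K [Kc K01 Ke Kf]] := L0rep_sm D e2.
have Kcpt : compact K.
  by apply: subclosed_compact Kc _ K01; exact: segment_compact.
have /compact_near_coveringP Kcov := continuous_compact Kf Kcpt.
pose V : set G := fun v => [set rep D x | x in K] `<=`
    (fun k => U (mul (mul (inv k) v) k)).
have VU : nbhs one V.
  apply: Kcov => k _.
  have : (fun p : G * G => mul (mul (inv p.1) p.2) p.1) @ (k, one) -->
      mul (mul (inv k) one) k.
    apply: (tg_cvgM tg); last exact: cvg_fst.
    by apply: (tg_cvgM tg); [apply: (tg_cvgV tg); exact: cvg_fst|exact: cvg_snd].
  rewrite (tg_mulg1 tg) (tg_mulVg tg); apply.
  exact: open_nbhs_nbhs.
exists V°, (e / 2); split=> //; first exact: open_interior.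
move=> E VE; apply: UA.
have aeD : ae_eq (rep (hmul (hmul (hinv D) E) D))
    (fun x => mul (mul (inv (rep D x)) (rep E x)) (rep D x)).
  apply: L0ae_trans (L0rep_mul _ _) _.
  apply: L0ae_map2 (L0ae_refl _); apply: L0ae_trans (L0rep_mul _ _) _.
  by apply: L0ae_map2 (L0ae_refl _); exact: L0rep_inv.
rewrite (L0N_defect _ _ aeD) (splitr e) EFinD.
apply: (@le_lt_trans _ _ (defect K + defect (fun x => V° (rep E x)))%E).
  apply: defect_and => x _ Kx /interior_subset VEx.
  by apply: VEx; exists x.
by apply: lee_ltD => //; exact: defect_fin_num.
Qed.

(* Keeps unification from unfolding classes to their representatives. *)
#[local] Opaque L0m L0i L0e L0N.

Lemma L0mulKg (C D : H) : hmul (hinv C) (hmul C D) = D.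
Proof. by rewrite L0mulA L0mulVg L0mul1g. Qed.


Lemma L0_topgroup : is_topgroup hmul hinv hone.
Proof.
split.
- exact: L0mulA.
- by move=> C; rewrite L0mul1g L0mulg1.
- by move=> C; rewrite L0mulVg L0mulgV.
- move=> [C D] A /= /L0_nbhsP[U [e [Uo U1 e0 UA]]].
  have [V [V1 VU]] := tg_nbhs_mul tg (open_nbhs_nbhs (conj Uo U1)).
  have e2 : 0 < e / 2 by rewrite divr_gt0.
  have Vs : L0small (L0N V° (e / 2)) by exists V°, (e / 2); split=> //; exact: open_interior.
  (* Basic neighbourhoods are left translates, so the perturbation of the first factor has to cross
     [D]: [(C a) (D b) = (C D) (D^-1 a D) b]. This is what [L0small_conj] is for. *)
  exists ([set E | L0N V° (e / 2) (hmul (hmul (hinv D) (hmul (hinv C) E)) D)],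
          [set E | L0N V° (e / 2) (hmul (hinv D) E)]) => /=.
    split; apply/L0_nbhsP => /=.
      have [W [d [Wo W1 d0 WV]]] := L0small_conj D Vs.
      exists W, d; split; [exact: Wo|exact: W1|exact: d0|move=> E WE].
      have := WV _ WE.
      rewrite /mkset L0mulKg.
      exact.
    have [W [d [Wo W1 d0 WV]]] := Vs.
    exists W, d; split; [exact: Wo|exact: W1|exact: d0|move=> E WE].
    by have := WV _ WE; rewrite /mkset L0mulKg; exact.
  move=> [E F] /= [E1 F1].
  have -> : hmul E F = hmul (hmul C D)
      (hmul (hmul (hmul (hinv D) (hmul (hinv C) E)) D) (hmul (hinv D) F)).
    rewrite !L0mulA -[hmul (hmul C D) (hinv D)]L0mulA L0mulgV L0mulg1 L0mulgV L0mul1g.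
    by rewrite -[hmul (hmul E D) _]L0mulA L0mulgV L0mulg1.
  apply: UA; rewrite (splitr e); apply: L0N_mul E1 F1 => a b.
  by move=> /interior_subset Va /interior_subset Vb; exact: VU.
- move=> C A /L0_nbhsP[U [e [Uo U1 e0 UA]]].
  have Us : L0small (L0N [set v | U (inv v)]° e).
    exists [set v | U (inv v)]°, e; split=> //; first exact: open_interior.
    by apply: (tg_nbhs_inv tg); exact: open_nbhs_nbhs.
  apply/L0_nbhsP; have [W [d [Wo W1 d0 WU]]] := L0small_conj (hinv C) Us.
  exists W, d; split=> // E /WU /= UE.
  have CC : hmul (hinv (hinv C)) (hinv C) = hone by exact: L0mulVg.
  have iiC : hinv (hinv C) = C.
    by rewrite -[LHS]L0mulg1 -(L0mulVg C) L0mulA CC L0mul1g.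
  have -> : hinv (hmul C E) = hmul (hinv C) (hinv (hmul (hmul C E) (hinv C))).
    have iu D F : hmul D F = hone -> F = hinv D.
      by move=> DF; rewrite -[F]L0mul1g -(L0mulVg D) -L0mulA DF L0mulg1.
    by apply/esym/iu; rewrite L0mulA L0mulgV.
  apply: UA; rewrite (L0N_defect _ _ (L0rep_inv _)); move: UE; rewrite iiC.
  by apply: le_lt_trans; apply: defect_le => x _ /interior_subset.
Qed.

End L0Group.

(** * Step functions in L^0(G) *)

Section Cells.
Variable R : realType.
Local Notation lambda := (@lebesgue_measure R).
Local Notation I01 := (`[(0:R), 1]%classic : set R).

(* [0,1] is cut into n.+1 cells of equal length, numbered from 0 to n *)
Definition cell (n : nat) (x : R) : nat := minn (Num.truncn (n.+1%:R * x)) n.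

Lemma cell_itv n x : I01 x ->
  (cell n x)%:R / n.+1%:R <= x <= (cell n x).+1%:R / n.+1%:R.
Proof.
rewrite /= in_itv/= => /andP[x0 x1].
have N0 : (0 : R) < n.+1%:R by rewrite ltr0n.
have Nx0 : 0 <= n.+1%:R * x by rewrite mulr_ge0// ltW.
have /andP[t1 t2] := truncn_itv Nx0.
rewrite ler_pdivrMr// ler_pdivlMr// [x * _]mulrC.
rewrite /cell; have [tn|nt] := leqP (Num.truncn (n.+1%:R * x)) n.
  by rewrite t1 ltW.
apply/andP; split; last by rewrite ler_piMr// ltW.
by apply: le_trans t1; rewrite ler_nat ltnW.
Qed.

Lemma cell_dist n x y : I01 x -> I01 y -> cell n x = cell n y ->
  `|x - y| <= n.+1%:R^-1.
Proof.
move=> /(cell_itv n)/andP[x1 x2] /(cell_itv n)/andP[y1 y2] xy.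
have e (k : nat) : k.+1%:R / n.+1%:R = k%:R / n.+1%:R + n.+1%:R^-1 :> R.
  by rewrite -[k.+1%:R]natr1 mulrDl mul1r.
move: x1 x2 y1 y2; rewrite xy !e.
move: n.+1%:R^-1 => b; move: (_ * b) => a x1 x2 y1 y2.
by rewrite ler_norml; apply/andP; split; lra.
Qed.

Lemma cell_lt n x : (cell n x < n.+1)%N.
Proof. by rewrite ltnS /cell geq_minr. Qed.

(** Each failing cell is covered by a closed interval of length [1 / n.+1]; shared endpoints do no
    harm to an upper bound. *)
Lemma defect_cell_le n (P : pred nat) :
  (defect (fun x : R => P (cell n x)) <=
   ((\sum_(k < n.+1) (~~ P k : nat))%:R / n.+1%:R)%:E)%E.
Proof.
suff h m : (lambda [set x | I01 x /\ ~ P (cell n x) /\ (cell n x < m)%N] <=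
    ((\sum_(k < m) (~~ P k : nat))%:R / n.+1%:R)%:E)%E.
  apply: le_trans (h n.+1); apply: le_lebesgue_outer => x [x01 nP].
  by split=> //; split=> //; exact: cell_lt.
elim: m => [|m IH].
  rewrite big_ord0 mul0r (_ : [set _ | _] = set0) ?measure0//.
  by apply/seteqP; split=> x // [_ []].
rewrite big_ord_recr/= natrD mulrDl EFinD.
apply: le_trans (leeD IH (lexx _)).
have [Pm|nPm] := boolP (P m).
  rewrite mul0r adde0; apply: le_lebesgue_outer => x [x01 [nP]].
  rewrite ltnS leq_eqVlt => /predU1P[xm|xm]; last by [].
  by case: nP; rewrite xm.
rewrite (_ : (_ / _)%:E = lambda `[(m%:R / n.+1%:R : R), (m.+1%:R / n.+1%:R)]%classic).
  apply: le_trans (lebesgue_outerU _ _); apply: le_lebesgue_outer.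
  move=> x [x01 [nP]]; rewrite ltnS leq_eqVlt => /predU1P[xm|xm]; last by left.
  by right; rewrite /= in_itv/= -xm; exact: cell_itv.
rewrite lebesgue_measure_itv/= lte_fin ltr_pM2r ?invr_gt0 ?ltr0n// ltr_nat ltnSn.
by rewrite -EFinB -mulrBl -[m.+1%:R]natr1 addrAC subrr add0r.
Qed.

End Cells.

Section StepFunctions.
Variables (R : realType) (G : topologicalType).
Variables (mul : G -> G -> G) (inv : G -> G) (one : G).
Hypothesis tg : is_topgroup mul inv one.
Local Notation lambda := (@lebesgue_measure R).
Local Notation I01 := (`[(0:R), 1]%classic : set R).
Implicit Types (f : R -> G) (g h : nat -> G).
Local Notation SM := (@strongly_measurable R G).
Local Notation H := (@L0 R G mul one).
Local Notation hmul := (@L0m R G mul one).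
Local Notation hinv := (@L0i R G mul inv one).
Local Notation hone := (@L0e R G mul one).
Local Notation rep := (@L0rep R G).

(** The half line [x < t] is not closed. Retreating to [x <= t - e / 3] gives a closed piece on
    which the map is [f], at the cost of a third of the error. *)
Lemma strongly_measurable_if f f' (t : R) : SM f -> SM f' ->
  SM (fun x => if x < t then f x else f' x).
Proof.
move=> fm fm' e e0; have e3 : 0 < e / 3 by rewrite divr_gt0.
have [A [Ac A01 Ae Af]] := fm _ e3; have [B [Bc B01 Be Bf]] := fm' _ e3.
have A'c : closed (A `&` `]-oo, t - e / 3]) by apply: closedI => //; exact: lray_closed.
have B'c : closed (B `&` `[t, +oo[) by apply: closedI => //; exact: rray_closed.
exists ((A `&` `]-oo, t - e / 3]) `|` (B `&` `[t, +oo[)); split.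
- exact: closedU.
- by move=> x [[/A01]|[/B01]].
- have dI : (defect (fun x : R => ~ (t - e / 3 <= x <= t)%R) <= (e / 3)%:E)%E.
    apply: (@le_trans _ _ (lambda `[(t - e / 3)%R, t]%classic)).
      by apply: le_lebesgue_outer => x [_ /contrapT]; rewrite /= in_itv.
    rewrite lebesgue_measure_itv/= lte_fin ltrBlDr ltrDl e3 -EFinB lee_fin.
    by rewrite opprB addrCA subrr addr0.
  apply: (@le_trans _ _ ((e / 3)%:E + ((e / 3)%:E + (e / 3)%:E))%E); last first.
    by rewrite -!EFinD lee_fin; lra.
  apply: le_trans (leeD dI (leeD Ae Be)).
  apply: le_trans (leeD (lexx _) (@defect_and _ A B (fun x => A x /\ B x) _)); last by [].
  apply: defect_and => x _ xt [Ax Bx].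
  have [xle|tx] := leP t x; first by right; split=> //=; rewrite in_itv/= xle.
  left; split=> //=; rewrite in_itv/= leNgt; apply/negP => ltx; apply: xt.
  by rewrite (ltW ltx) (ltW tx).
- apply: withinU_continuous => //.
    apply: (@subspace_eq_continuous _ _ _ (f : subspace _ -> G)).
      move=> x; rewrite inE => -[_ /=]; rewrite in_itv/= => xt.
      by rewrite /from_subspace; have -> : x < t by rewrite (le_lt_trans xt)// ltrBlDr ltrDl.
    by apply: continuous_subspaceW Af; exact: subIsetl.
  apply: (@subspace_eq_continuous _ _ _ (f' : subspace _ -> G)).
    move=> x; rewrite inE => -[_ /=]; rewrite in_itv/= andbT => tx.
    by rewrite /from_subspace; have /negbTE -> : ~~ (x < t) by rewrite -leNgt.
  by apply: continuous_subspaceW Bf; exact: subIsetl.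
Qed.

Definition step (n : nat) g : H := L0of one (fun x => g (cell n x)).

Lemma strongly_measurable_step n g : SM (fun x => g (cell n x)).
Proof.
(* Only the cap of [minn] is generalised, not the mesh: raising the cap from [k] to [k.+1] adds one
   jump. *)
rewrite /cell; elim: {2}n => [|k IH].
  rewrite (_ : (fun _ => _) = fun _ => g 0%N); first exact: strongly_measurable_cst.
  by apply/funext => x; rewrite minn0.
rewrite (_ : (fun _ => _) = fun x : R => if x < k.+1%:R / n.+1%:R then
    g (minn (Num.truncn (n.+1%:R * x)) k) else g k.+1).
  by apply: strongly_measurable_if => //; exact: strongly_measurable_cst.
apply/funext => x; rewrite ltr_pdivlMr ?ltr0n// mulrC -truncn_le_nat.
case: leqP => tk; congr g.
  by rewrite !(minn_idPl _)// leqW.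
exact/minn_idPr.
Qed.

Lemma L0rep_step n g : ae_eq (rep (step n g)) (fun x => g (cell n x)).
Proof. by apply: L0rep_of; exact: strongly_measurable_step. Qed.

Lemma step_mul n g h : hmul (step n g) (step n h) = step n (fun k => mul (g k) (h k)).
Proof.
apply: L0_eq; apply: L0ae_trans (L0rep_mul tg _ _) _.
apply: L0ae_trans (L0ae_map2 mul (L0rep_step n g) (L0rep_step n h)) _.
exact/L0ae_sym/L0rep_step.
Qed.

Lemma L0ae_div (C D : H) f f' : ae_eq (rep C) f -> ae_eq (rep D) f' ->
  ae_eq (rep (hmul C (hinv D))) (fun x => mul (f x) (inv (f' x))).
Proof.
move=> Cf Df; apply: L0ae_trans (L0rep_mul tg _ _) _.
apply: L0ae_map2 => //; apply: L0ae_trans (L0rep_inv tg _) _.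
exact: L0ae_map.
Qed.

Lemma step_div_L0N n g h (U : set G) (d : R) :
  (\sum_(k < n.+1) (~~ `[< U (mul (g k) (inv (h k))) >] : nat))%:R < d * n.+1%:R ->
  L0N U d (hmul (step n g) (hinv (step n h))).
Proof.
move=> lt_d; rewrite (L0N_defect _ _ (L0ae_div (L0rep_step n g) (L0rep_step n h))).
have := defect_cell_le R n (fun k => `[< U (mul (g k) (inv (h k))) >]).
move=> /(@le_lt_trans _ _ _ _ _)/(_ (_ : _ < d%:E)%E) h'.
apply: le_lt_trans (h' _); last by rewrite lte_fin ltr_pdivrMr ?ltr0n.
by apply: defect_le => x _ /asboolP.
Qed.

(** Off a set of measure at most [e / 2] the representative lives on a compact [K] where it is
    uniformly continuous, so sampling it at one point of [K] per cell suffices once the cells are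
    short. *)
Lemma step_approx (C : H) (U : set G) (e : R) : nbhs one U -> 0 < e ->
  \forall n \near \oo, exists g, L0N U e (hmul C (hinv (step n g))).
Proof.
move=> U1 e0; have e2 : 0 < e / 2 by rewrite divr_gt0.
have [K [Kc K01 Ke Kf]] := L0rep_sm C e2.
have Kcpt : compact K.
  by apply: subclosed_compact Kc _ K01; exact: segment_compact.
have /compact_near_coveringP/near_covering_withinP Kcov := Kcpt.
pose P (n : nat) (x : R) := forall y, K y -> `|x - y| <= n.+1%:R^-1 ->
  U (mul (rep C x) (inv (rep C y))).
have : \forall n \near \oo, K `<=` P n.
  apply: Kcov => x Kx.
  have : (fun p : G * G => mul p.1 (inv p.2)) @ (rep C x, rep C x) -->
      mul (rep C x) (inv (rep C x)).
    by apply: (tg_cvgM tg); [exact: cvg_fst|apply: (tg_cvgV tg); exact: cvg_snd].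
  rewrite (tg_mulgV tg) => /(_ _ U1)[[A B] /= [A1 B1] AB].
  have /nbhs_ballP[r /= r0 rAB] : nbhs x [set z | K z -> (A `&` B) (rep C z)].
    exact: ((subspace_continuousP K (rep C)).1 Kf x Kx _ (filterI A1 B1)).
  have r2 : 0 < r / 2 by rewrite divr_gt0.
  exists (ball x (r / 2), [set n | n.+1%:R^-1 < r / 2]).
    split; first exact: nbhsx_ballx.
    exact: (near_infty_natSinv_lt (PosNum r2)).
  move=> [z n] /= [xz nr] Kz y Ky zy.
  have [Az _] : (A `&` B) (rep C z).
    apply: rAB => //; apply: le_ball xz.
    by rewrite ler_pdivrMr// ler_pMr// ler1n.
  have [_ By] : (A `&` B) (rep C y).
    apply: rAB => //; rewrite -ball_normE/= (splitr r).
    rewrite (le_lt_trans (ler_distD z _ _))// ltrD//.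
    exact: le_lt_trans zy nr.
  exact: (AB (_, _)).
apply: filterS => n KP.
(* The value [one] on cells missing [K] is harmless: the estimate concerns points of [K] only. *)
pose g k := if pselect (exists2 y, K y & cell n y = k) is left p
  then rep C (sval (cid2 p)) else one.
exists g; rewrite (L0N_defect _ _ (L0ae_div (L0ae_refl (rep C)) (L0rep_step n g))).
apply: (@le_lt_trans _ _ (e / 2)%:E); last by rewrite lte_fin ltr_pdivrMr// ltr_pMr// ltr1n.
apply: le_trans Ke; apply: defect_le => x x01 Kx; rewrite /g.
case: pselect => [p|[]]; last by exists x.
case: cid2 => y Ky /= yx; apply: KP => //.
by apply: cell_dist => //; exact: K01.
Qed.

End StepFunctions.

(** * Concentration of measure *)

Section InfConvolution.
Variables (R : realType) (T : eqType) (N : nat) (c : R).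
Hypothesis c0 : 0 <= c.
Implicit Types (h : nat -> T) (psi : (nat -> T) -> R).

Definition hamming h h' : nat := \sum_(k < N) (h k != h' k).

Lemma hammingxx h : hamming h h = 0%N.
Proof. by rewrite /hamming big1// => k _; rewrite eqxx. Qed.

Lemma hamming_tri h1 h2 h3 : (hamming h1 h3 <= hamming h1 h2 + hamming h2 h3)%N.
Proof.
rewrite /hamming -big_split/=; apply: leq_sum => k _.
by case: (eqVneq (h1 k) (h2 k)) => [->|]//; rewrite ?add0n// (leq_trans (leq_b1 _)).
Qed.

Lemma hamming_upd h k s t : (hamming (upd h k s) (upd h k t) <= 1)%N.
Proof.
rewrite /hamming /upd; have [kN|Nk] := ltnP k N; last first.
  rewrite big1// => i _; have /ltn_eqF -> : (i < k)%N by exact: leq_trans Nk.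
  by rewrite eqxx.
rewrite (bigD1 (Ordinal kN))//= big1 ?addn0 ?leq_b1// => i ik.
have /negbTE -> : (i : nat) != k by apply: contraNneq ik => ik; apply/eqP/val_inj.
by rewrite eqxx.
Qed.

Lemma hamming_map (u : nat -> T -> T) h h' :
  (hamming (fun k => u k (h k)) (fun k => u k (h' k)) <= hamming h h')%N.
Proof.
by apply: leq_sum => k _; case: (eqVneq (h k) (h' k)) => [->|_]; rewrite ?eqxx// leq_b1.
Qed.

(** The Pasch-Hausdorff envelope: for bounded [psi], the largest minorant that is [c]-Lipschitz for
    the Hamming distance. *)
Definition infconv psi h : R :=
  inf [set psi h' + c * (hamming h h')%:R | h' in [set: nat -> T]].

Variable psi : (nat -> T) -> R.
Hypothesis psi1 : forall h, `|psi h| <= 1.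

Lemma infconv_le h h' : infconv psi h <= psi h' + c * (hamming h h')%:R.
Proof.
apply: ge_inf; last by exists h'.
exists (-1) => _ [h'' _ <-]; have := psi1 h''; rewrite ler_norml => /andP[p _].
by rewrite (le_trans p)// lerDl mulr_ge0.
Qed.

Lemma le_infconv h a :
  (forall h', a <= psi h' + c * (hamming h h')%:R) -> a <= infconv psi h.
Proof.
move=> ah; apply: lb_le_inf; first by exists (psi h + c * (hamming h h)%:R), h.
by move=> _ [h' _ <-].
Qed.

Lemma infconv_le_id h : infconv psi h <= psi h.
Proof. by rewrite (le_trans (infconv_le h h))// hammingxx mulr0 addr0. Qed.

Lemma infconv_norm_le1 h : `|infconv psi h| <= 1.
Proof.
rewrite ler_norml; apply/andP; split; last first.
  by apply: le_trans (infconv_le_id h) _; have := psi1 h; rewrite ler_norml => /andP[].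
apply: le_infconv => h'; have := psi1 h'; rewrite ler_norml => /andP[p _].
by rewrite (le_trans p)// lerDl mulr_ge0.
Qed.

(** Since [|psi| <= 1], a point whose penalty is at least 2 cannot undercut [psi h]; only near
    points compete. *)
Lemma infconv_approx h e : 0 <= e ->
  (forall h', c * (hamming h h')%:R < 2 -> `|psi h - psi h'| <= e) ->
  `|infconv psi h - psi h| <= e.
Proof.
move=> e0 he; rewrite ler_distl; apply/andP; split; last first.
  by rewrite (le_trans (infconv_le_id h))// lerDl.
apply: le_infconv => h'; have [/he|ge2] := ltP (c * (hamming h h')%:R) 2.
  rewrite ler_norml => /andP[_ p]; have : 0 <= c * (hamming h h')%:R by exact: mulr_ge0.
  by move=> ?; lra.
by have := psi1 h; have := psi1 h'; rewrite !ler_norml => /andP[? ?] /andP[? ?]; lra.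
Qed.

Lemma infconv_lip h h' : infconv psi h <= infconv psi h' + c * (hamming h h')%:R.
Proof.
rewrite -lerBlDr; apply: le_infconv => h''; rewrite lerBlDr.
rewrite (le_trans (infconv_le h h''))// -addrA lerD2l -mulrDr ler_wpM2l//.
by rewrite -natrD ler_nat addnC hamming_tri.
Qed.

Lemma infconv_upd h k s t :
  `|infconv psi (upd h k s) - infconv psi (upd h k t)| <= c.
Proof.
have h1 s' t' : infconv psi (upd h k s') <= infconv psi (upd h k t') + c.
  apply: le_trans (infconv_lip _ (upd h k t')) _; rewrite lerD2l ler_piMr//.
  by rewrite -[1]/(1%:R) ler_nat hamming_upd.
by rewrite ler_distlC lerBlDr !h1.
Qed.

(** Coordinatewise maps do not increase the Hamming distance, so competitors can be transported by
    [u]. This is how right uniform continuity survives the regularisation. *)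
Lemma infconv_translate (u : nat -> T -> T) h e :
  (forall h', psi (fun k => u k (h' k)) <= psi h' + e) ->
  infconv psi (fun k => u k (h k)) <= infconv psi h + e.
Proof.
move=> ue; rewrite -lerBlDr; apply: le_infconv => h'; rewrite lerBlDr.
apply: le_trans (infconv_le _ (fun k => u k (h' k))) _; rewrite addrAC lerD//.
by rewrite ler_wpM2l// ler_nat hamming_map.
Qed.

End InfConvolution.

Lemma near_forall_seq (T : eqType) (I : Type) (F : set_system I) {FF : Filter F}
    (P : T -> I -> Prop) (s : seq T) :
  (forall t, t \in s -> \forall i \near F, P t i) ->
  \forall i \near F, forall t, t \in s -> P t i.
Proof.
elim: s => [_|t s IH ts]; first by apply: filterE.
have Ps : \forall i \near F, forall u, u \in s -> P u i.
  by apply: IH => u us; apply: ts; rewrite inE us orbT.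
apply: filterS2 (ts t (mem_head _ _)) Ps => i Pti Psi u.
by rewrite inE => /predU1P[->|/Psi].
Qed.

Section Concentration.
Variables (R : realType) (G : topologicalType).
Variables (mul : G -> G -> G) (inv : G -> G) (one : G).
Hypothesis tg : is_topgroup mul inv one.
Local Notation H := (@L0 R G mul one).
Local Notation hmul := (@L0m R G mul one).
Local Notation hinv := (@L0i R G mul inv one).
Local Notation hone := (@L0e R G mul one).
Local Notation step := (@step R G mul one).

Lemma step_translate_div n (u h : nat -> G) (U : set G) (d : R) :
  0 < d -> (forall k, U (u k)) ->
  L0N U d (hmul (step n (fun k => mul (u k) (h k))) (hinv (step n h))).
Proof.
move=> d0 Uu; apply: (step_div_L0N tg); rewrite big1 => [|k _].
  by rewrite mulr_gt0// ltr0n.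
by rewrite (tg_mulgK tg) asboolT.
Qed.

Lemma step_hamming_div n (h h' : nat -> G) (U : set G) (d : R) :
  U one -> (hamming n.+1 h h')%:R < d * n.+1%:R ->
  L0N U d (hmul (step n h) (hinv (step n h'))).
Proof.
move=> U1 hd; apply: (step_div_L0N tg); apply: le_lt_trans hd.
rewrite ler_nat; apply: leq_sum => k _.
by case: (eqVneq (h k) (h' k)) => [->|_]; rewrite ?leq_b1// (tg_mulgV tg) asboolT.
Qed.

(* The functions psi o step are replaced by their inf-convolutions with a
   multiple of the Hamming distance. These are Lipschitz for that distance, so
   their variance is O(1/n) under any product measure, and they remain right
   uniformly continuous because the Hamming distance is left invariant. *)
Lemma L0_concentration (Psi : set (H -> R)) (Cs : seq H) (e : R) :
  amenable R mul inv one ->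
  (forall psi C, Psi psi -> `|psi C| <= 1) ->
  (forall eta : R, 0 < eta -> exists A, nbhs hone A /\
     forall psi C D, Psi psi -> A (hmul C (hinv D)) -> `|psi C - psi D| <= eta) ->
  0 < e ->
  exists2 L : seq (R * H), is_prob L & forall psi C, Psi psi -> C \in Cs ->
    Ex L (fun h => (psi (hmul C h) - psi h) ^+ 2) <= e.
Proof.
move=> am Psi1 Psic e0.
(* The final count is [30 = 4 * 2 + 4 + 18], from [FT], [FV] and the last term of [ptw]; [e1 <= 1]
   bounds the square of [3 * e1] by [9 * e1]. *)
pose e1 := Num.min 1 (e / 30).
have e10 : 0 < e1 by rewrite lt_min ltr01 divr_gt0.
have e11 : e1 <= 1 by rewrite ge_min lexx.
have e1e : 30 * e1 <= e by rewrite mulrC -ler_pdivlMr// ge_min lexx orbT.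
have [A [/(L0_nbhs1P tg)[U [d [Uo U1 d0 UA]]] AP]] := Psic _ e10.
have Unb : nbhs one U by exact: open_nbhs_nbhs.
(* The mesh serves two purposes: steps approximate all of [Cs] up to [N(U, d)], and the variance
   bound [4 / (d ^ 2 * n.+1)] falls below [e1]. *)
have [n [gP n_large]] : exists n,
    (forall C, C \in Cs -> exists g, L0N U d (hmul C (hinv (step n g)))) /\
    n.+1%:R^-1 < e1 * d ^+ 2 / 4.
  apply: (@filter_ex _ (\oo : set_system nat)); apply: filterI.
    exact: (@near_forall_seq H nat \oo _
      (fun C n => exists g, L0N U d (hmul C (hinv (step n g)))) Cs
      (fun C _ => step_approx tg C Unb d0)).
  have p : 0 < e1 * d ^+ 2 / 4 by rewrite divr_gt0// mulr_gt0// exprn_gt0.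
  exact: (near_infty_natSinv_lt (PosNum p)).
have {gP} [g0 g0P] : {g0 : H -> nat -> G &
    forall C, C \in Cs -> L0N U d (hmul C (hinv (step n (g0 C))))}.
  apply: (@choice _ _ (fun C g => C \in Cs -> L0N U d (hmul C (hinv (step n g))))).
  move=> C; have [/gP[g gC]|nC] := boolP (C \in Cs); first by exists g.
  by exists (fun _ => one).
(* The cells never see indices beyond [n]; with [one] there, multiplying all coordinates is the same
   as multiplying the first [n.+1], as in [translate_pow_le]. *)
pose g C k := if (k < n.+1)%N then g0 C k else one.
have stepg C : step n (g C) = step n (g0 C).
  by congr L0of; apply/funext => x; rewrite /g cell_lt.
have N0 : 0 < n.+1%:R :> R by rewrite ltr0n.
(* With this slope a penalty below 2 means a Hamming distance below [d * n.+1], hence step functions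
   that differ on measure less than [d]. *)
pose c := 2 / (d * n.+1%:R).
have c0 : 0 <= c by rewrite divr_ge0// mulr_ge0// ltW.
pose psit psi := infconv n.+1 c (fun h => psi (step n h)).
have psit_approx psi h : Psi psi -> `|psit psi h - psi (step n h)| <= e1.
  move=> Ppsi; apply: (infconv_approx c0) => [h'||h'];
    [exact: Psi1|exact: ltW|].
  rewrite /c mulrAC ltr_pdivrMr ?mulr_gt0// ltr_pM2l// => hd.
  by apply: AP => //; apply: UA; exact: step_hamming_div.
have psit1 psi h : Psi psi -> `|psit psi h| <= 1.
  by move=> Ppsi; apply: infconv_norm_le1 => // h'; exact: Psi1.
have psit_RUC eta : 0 < eta -> exists V, nbhs one V /\ forall psi h k s t,
    Psi psi -> V (mul s (inv t)) ->
    `|psit psi (upd h k s) - psit psi (upd h k t)| <= eta.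
  move=> eta0.
  have [B [/(L0_nbhs1P tg)[W [d' [Wo W1 d'0 WB]]] BP]] := Psic _ eta0.
  pose V := W `&` [set v | W (inv v)].
  have Wnb : nbhs one W by exact: open_nbhs_nbhs.
  exists V; split; first by apply: filterI => //; exact: (tg_nbhs_inv tg).
  have half psi h k s t : Psi psi -> W (mul s (inv t)) ->
      psit psi (upd h k s) <= psit psi (upd h k t) + eta.
    move=> Ppsi Wst.
    (* Changing one coordinate from [t] to [s] is a left translation by a sequence with all values
       in [W], whatever the size of the cells. *)
    pose u i := if i == k then mul s (inv t) else one.
    have -> : upd h k s = (fun i => mul (u i) (upd h k t i)).
      apply/funext => i; rewrite /upd /u; case: eqP => _.
        by rewrite (tg_mulgKV tg).
      by rewrite (tg_mul1g tg).
    apply: (@infconv_translate _ _ _ _ c0 (fun h => psi (step n h)) _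
      (fun i => mul (u i))) => h'; first exact: Psi1.
    rewrite -lerBlDl; apply: le_trans (ler_norm _) _; apply: BP => //; apply: WB.
    by apply: step_translate_div => // i; rewrite /u; case: ifP.
  move=> psi h k s t Ppsi [Wst]; rewrite /mkset (tg_invM tg) (tg_invK tg) => Wts.
  by rewrite ler_distlC lerBlDr !half.
(* The constant [a] stands for the mean of [psit psi]. It has to range over all of [[-1, 1]], since
   that mean depends on the measure [L] still to be found. *)
pose Hs : set (G -> R) := [set u | exists psi h k a, [/\ Psi psi, `|a| <= 1 &
  u = fun s => (psit psi (upd h k s) - a) ^+ 2]].
have sqr_le (x a : R) : `|x| <= 1 -> `|a| <= 1 -> `|x - a| <= 2.
  by move=> x1 a1; rewrite (le_trans (ler_normB _ _))// -[2]/(1 + 1) lerD.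
pose gs := flatten [seq mkseq (g C) n.+1 | C <- Cs].
(* The accuracy [e1 / n.+1] pays for [n.+1] coordinates translated in turn; 4 bounds the squared
   difference of two numbers in [[-1, 1]]. *)
have [|||L Lp LP] := @uniform_amenability R G mul inv one tg Hs 4 (e1 / n.+1%:R) gs am.
- move=> _ x [psi [h [k [a [Ppsi a1 ->]]]]]; rewrite normrX.
  have := sqr_le _ _ (psit1 psi (upd h k x) Ppsi) a1.
  by move=> le2; rewrite (_ : 4 = 2 ^+ 2) ?lerXn2r ?nnegrE// expr2; lra.
- move=> eta eta0; have [|V [V1 VP]] := psit_RUC (eta / 4); first by rewrite divr_gt0.
  exists V; split=> // _ x y [psi [h [k [a [Ppsi a1 ->]]]]] Vxy.
  rewrite subr_sqr normrM.
  have -> : eta = eta / 4 * 4 by rewrite divfK.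
  apply: ler_pM => //.
    by rewrite opprB addrA subrK; exact: VP.
  apply: le_trans (ler_normD _ _) _; rewrite (_ : 4 = 2 + 2); last by lra.
  by apply: lerD; apply: sqr_le => //; exact: psit1.
- by rewrite divr_gt0.
pose P := pow_prob one L n.+1.
have Pp : is_prob P by exact: is_prob_pow.
exists [seq (x.1, step n x.2) | x <- P]; first exact: is_prob_map.
move=> psi C Ppsi CCs; rewrite Ex_map.
pose a := Ex P (psit psi).
have a1 : `|a| <= 1 by apply: Ex_prob_norm_le => // h; exact: psit1.
pose F h := (psit psi h - a) ^+ 2.
have FV : Ex P F <= e1.
  have -> : Ex P F = Ex P (fun h => psit psi h ^+ 2) - Ex P (psit psi) ^+ 2.
    rewrite -/a (_ : F = fun h => psit psi h ^+ 2 - 2 * a * psit psi h + a ^+ 2).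
      by rewrite ExD ExB ExZ -/a Ex_prob_cst//; ring.
    by apply/funext => h; rewrite /F; ring.
  apply: (@le_trans _ _ (n.+1%:R * c ^+ 2)).
    by apply: variance_pow_le => // h k s t; apply: infconv_upd => // h'; exact: Psi1.
  rewrite /c (_ : _ * _ = n.+1%:R^-1 * (4 / d ^+ 2)); last first.
    by field; rewrite ?gt_eqF.
  rewrite ltW// -ltr_pdivlMr ?divr_gt0 ?exprn_gt0//.
  by rewrite invf_div mulrA.
have FT : Ex P (fun h => F (fun k => mul (g C k) (h k))) <= 2 * e1.
  have := @translate_pow_le R G one L n.+1 (fun k => mul (g C k)) F (e1 / n.+1%:R) Lp.
  rewrite mulrCA divff ?gt_eqF// mulr1.
  have -> : (fun h => F (fun k => if (k < n.+1)%N then mul (g C k) (h k) else h k)) =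
            (fun h => F (fun k => mul (g C k) (h k))).
    apply/funext => h; congr F; apply/funext => k; rewrite /g.
    by case: (k < n.+1)%N; rewrite ?(tg_mul1g tg).
  move=> /(_ _)/ler_normlW; rewrite lerBlDr => h; apply: (le_trans (h _)).
    move=> h' k i iN; apply: (LP (fun s => F (upd h' k s))).
      by exists psi, h', k, a.
    apply/flattenP; exists (mkseq (g C) n.+1); first by apply/mapP; exists C.
    by apply/mapP; exists i => //; rewrite mem_iota.
  by rewrite mulr2n mulrDl mul1r lerD2l.
(* Write the difference as [r + (p - q)], with [r] the approximation errors, at most [3 * e1] in
   absolute value, and compare [p] and [q] through [a], using the inequality
   [(x + y)^2 <= 2 x^2 + 2 y^2] twice. *)
have ptw h : (psi (hmul C (step n h)) - psi (step n h)) ^+ 2 <=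
    4 * F (fun k => mul (g C k) (h k)) + 4 * F h + 18 * e1.
  rewrite /F; set gh := fun k => _; set p := psit psi gh; set q := psit psi h.
  have pe : `|psi (hmul C (step n h)) - p| <= 2 * e1.
    apply: le_trans (ler_distD (psi (step n gh)) _ _) _.
    rewrite mulr2n mulrDl mul1r lerD//; last by rewrite distrC; exact: psit_approx.
    apply: AP => //; apply: UA.
    rewrite /gh -(step_mul R tg) stepg.
    by rewrite (tg_divM (L0_topgroup R tg)); exact: g0P.
  have qe : `|q - psi (step n h)| <= e1 by exact: psit_approx.
  move: pe qe; move: (psi (hmul C _)) (psi (step n h)) => x y.
  rewrite !ler_norml => /andP[x1 x2] /andP[y1 y2].
  have r1 : (x - p + (q - y)) ^+ 2 <= 9 * e1.
    have : 0 <= (3 * e1 - (x - p + (q - y))) * (3 * e1 + (x - p + (q - y))).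
      by apply: mulr_ge0; lra.
    have : 0 <= e1 * (1 - e1) by apply: mulr_ge0; lra.
    by lra.
  have := sqr_ge0 ((p - a) + (q - a)).
  have := sqr_ge0 ((x - p + (q - y)) - (p - q)).
  by lra.
apply: (@le_trans _ _ (Ex P (fun h =>
    4 * F (fun k => mul (g C k) (h k)) + 4 * F h + 18 * e1))).
  exact: ler_Ex Pp.1 ptw.
rewrite !ExD !ExZ Ex_prob_cst//; lra.
Qed.

End Concentration.

(** * Actions of L^0(G) on compact spaces *)

Section CompactActions.
Variables (R : realType) (G : topologicalType).
Variables (mul : G -> G -> G) (one : G).
Variables (X : ptopologicalType) (act : G -> X -> X).
Hypotheses (cX : compact [set: X]) (hX : hausdorff_space X).
Hypothesis cact : continuous_action mul one act.
Implicit Type phi : X -> R.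

Definition unit_fct phi : Prop := continuous phi /\ forall x, `|phi x| <= 1.

Lemma act_continuous g : continuous (act g).
Proof.
case: cact => _ _ ca x.
apply: (@cvg_comp _ _ _ (fun y => (g, y)) (fun p => act p.1 p.2) _ (nbhs (g, x)));
  last exact: (ca (g, x)).
by apply: cvg_pair; [exact: cvg_cst|exact: cvg_id].
Qed.

Lemma displacement_continuous phi g : continuous phi ->
  continuous (fun x => (phi (act g x) - phi x) ^+ 2).
Proof.
move=> cphi x.
apply: (@continuous_comp _ _ _ (fun x => phi (act g x) - phi x) (fun y => y ^+ 2));
  last exact: exprn_continuous.
apply: cvgB; last exact: cphi.
by apply: (@continuous_comp _ _ _ (act g) phi); [exact: act_continuous|exact: cphi].
Qed.

(** A tube argument: compactness of [X] makes the neighbourhood independent of [x], which gives all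
    orbit functions of [phi] a common modulus. *)
Lemma act_equicontinuous phi (eta : R) : continuous phi -> 0 < eta ->
  \forall g \near one, forall x, `|phi (act g x) - phi x| <= eta.
Proof.
move=> cphi eta0; have /compact_near_coveringP cov := cX.
have : \forall g \near one, [set: X] `<=` (fun x => `|phi (act g x) - phi x| <= eta).
  apply: cov => x _.
  have c : (fun p : X * G => phi (act p.2 p.1) - phi p.1) @ (x, one) -->
      phi (act one x) - phi x.
    apply: cvgB.
      apply: (@cvg_comp _ _ _ (fun p : X * G => act p.2 p.1) phi _ (nbhs (act one x))).
        case: cact => _ _ ca.
        apply: (@cvg_comp _ _ _ (fun p : X * G => (p.2, p.1))
          (fun p => act p.1 p.2) _ (nbhs (one, x))); last exact: (ca (one, x)).
        by apply: cvg_pair; [exact: cvg_snd|exact: cvg_fst].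
      exact: cphi.
    apply: (@cvg_comp _ _ _ (fun p : X * G => p.1) phi _ (nbhs x)).
      exact: cvg_fst.
    exact: cphi.
  move: c; have -> : act one x = x by case: cact.
  rewrite subrr => /cvgrPdist_le /(_ _ eta0).
  by apply: filterS => -[y g] /=; rewrite sub0r normrN.
by apply: filterS => g h x; exact: h.
Qed.

Lemma unit_fct_separates (x y : X) : x <> y ->
  exists2 phi : X -> R, unit_fct phi & phi x != phi y.
Proof.
move=> xy; have := (@normal_separatorP R X).1 (compact_normal hX cX) [set x] [set y].
case/(_ _ _ _)/(@uniform_separatorP X R).
- exact/accessible_closed_set1/hausdorff_accessible.
- exact/accessible_closed_set1/hausdorff_accessible.
- by apply/seteqP; split=> z // [-> /= yx]; exact: xy.
move=> phi [cphi phi01 phi0 phi1]; exists phi.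
  split=> // z; have /= := phi01 (phi z); rewrite in_itv/=.
  by case/(_ _)/andP => [|z0 z1]; [exists z|rewrite ger0_norm].
have -> : phi x = 0 by apply: phi0; exists x.
have -> : phi y = 1 by apply: phi1; exists y.
by rewrite eq_sym oner_neq0.
Qed.

Lemma fixed_pointsE : fixed_points act =
  \bigcap_(i in [set i : (X -> R) * G | unit_fct i.1])
     [set x | (i.1 (act i.2 x) - i.1 x) ^+ 2 <= 0].
Proof.
apply/seteqP; split=> [x fx [phi g] _ /=|x fx g]; first by rewrite fx subrr expr0n.
apply: contrapT => /unit_fct_separates[phi uphi]; apply/negP; rewrite negbK.
have := fx (phi, g) uphi; rewrite /= le_eqVlt ltNge sqr_ge0 orbF.
by rewrite sqrf_eq0 subr_eq0.
Qed.

Lemma closed_le_displacement (i : (X -> R) * G) (t : R) : unit_fct i.1 ->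
  closed [set x | (i.1 (act i.2 x) - i.1 x) ^+ 2 <= t].
Proof.
move=> ui; apply: (@closed_comp _ _ _ [set y | y <= t]); last exact: closed_le.
by move=> x _; apply: displacement_continuous; exact: ui.1.
Qed.

Lemma open_gt_displacement (i : (X -> R) * G) (t : R) : unit_fct i.1 ->
  open [set x | t < (i.1 (act i.2 x) - i.1 x) ^+ 2].
Proof.
move=> ui; rewrite -closedC (_ : ~` _ = [set x | (i.1 (act i.2 x) - i.1 x) ^+ 2 <= t]).
  exact: closed_le_displacement.
by apply/seteqP; split=> x /=; rewrite leNgt => /negP.
Qed.

Lemma closed_fixed_points : closed (fixed_points act).
Proof.
rewrite fixed_pointsE; apply: closed_bigI => i ui.
exact: closed_le_displacement.
Qed.

(** One [L] serves all [x] at once, as integration over [X] will demand. *)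
Definition concentrating : Prop :=
  forall (s : seq ((X -> R) * G)) (e : R),
    (forall i, i \in s -> unit_fct i.1) -> 0 < e ->
    exists2 L : seq (R * G), is_prob L & forall i x, i \in s ->
      Ex L (fun h => (i.1 (act i.2 (act h x)) - i.1 (act h x)) ^+ 2) <= e.

(** By compactness it is enough to make finitely many displacements vanish. At a minimum [x] of
    their sum [Q], the value [Q x] is at most the average of [Q] over the points [act h x], which is
    arbitrarily small. *)
Lemma concentrating_fixed_point : concentrating ->
  exists x, fixed_points act x.
Proof.
move=> conc; rewrite fixed_pointsE.
have := cX; rewrite compact_In0; apply.
  exists (fun i => [set x | (i.1 (act i.2 x) - i.1 x) ^+ 2 <= 0]).
    by move=> i ui; exact: closed_le_displacement.
  by move=> i _; rewrite setTI.
move=> F FD.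
have us i : i \in finmap.enum_fset F -> unit_fct i.1.
  by move=> iF; have /set_mem := FD i iF.
suff [x xs] : exists x, forall i, i \in finmap.enum_fset F ->
    (i.1 (act i.2 x) - i.1 x) ^+ 2 <= 0 by exists x => i; exact: xs.
move: (finmap.enum_fset F) us => s {F FD} us.
pose Q x := \sum_(i <- s) (i.1 (act i.2 x) - i.1 x) ^+ 2.
have Qc : continuous Q.
  rewrite /Q; clear Q; elim: s us => [|i s IH] us x.
    rewrite (_ : (fun _ => _) = fun _ => 0); first exact: cvg_cst.
    by apply/funext => y; rewrite big_nil.
  rewrite (_ : (fun _ => _) = fun x => (i.1 (act i.2 x) - i.1 x) ^+ 2 +
      \sum_(j <- s) (j.1 (act j.2 x) - j.1 x) ^+ 2); last first.
    by apply/funext => y; rewrite big_cons.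
  apply: cvgD; first by apply: displacement_continuous; exact: (us i (mem_head _ _)).1.
  by apply: IH => j js; apply: us; rewrite inE js orbT.
have [x _ xmin] : exists2 c : X, c \in [set: X] & forall t, t \in [set: X] -> Q c <= Q t.
  apply: compact_EVT_min => //; first by exists point.
  exact: continuous_subspaceT.
have Q0 : Q x <= 0.
  apply/ler_addgt0Pl => e e0; rewrite addr0.
  have e'0 : 0 < e / (size s).+1%:R by rewrite divr_gt0// ltr0n.
  have [L Lp LP] := conc s _ us e'0.
  apply: (@le_trans _ _ (Ex L (fun h => Q (act h x)))).
    rewrite -[leLHS](Ex_prob_cst _ Lp); apply: ler_Ex Lp.1 _ => h.
    by apply: xmin; rewrite inE.
  have -> : Ex L (fun h => Q (act h x)) = \sum_(i <- s)
      Ex L (fun h => (i.1 (act i.2 (act h x)) - i.1 (act h x)) ^+ 2).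
    by rewrite /Ex exchange_big/=; apply: eq_bigr => l _; rewrite /Q mulr_sumr.
  apply: (@le_trans _ _ (\sum_(i <- s) (e / (size s).+1%:R))).
    by rewrite big_seq [leRHS]big_seq; apply: ler_sum => i /LP; exact.
  rewrite big_const_seq count_predT iter_addr_0 -[leLHS]mulr_natl mulrCA ger_pMr//.
  by rewrite ler_pdivrMr ?ltr0n// mul1r ler_nat.
exists x => i si; apply: le_trans Q0; rewrite /Q (big_rem i si)/= lerDl.
by apply: sumr_ge0 => j _; exact: sqr_ge0.
Qed.

Lemma open_measurable_Borel (A : set X) : open A -> measurable (A : set (Borel X)).
Proof. by move=> Ao; exact: sub_sigma_algebra. Qed.

Lemma closed_measurable_Borel (A : set X) : closed A -> measurable (A : set (Borel X)).
Proof.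
move=> Ac; rewrite -(setCK A); apply: measurableC.
by apply: open_measurable_Borel; exact: closed_openC.
Qed.

Lemma integral_Ex_indic (mu : probability (Borel X) R) (m : R)
    (A : G -> set (Borel X)) (L : seq (R * G)) :
  nneg_weights L -> (forall h, measurable (A h)) -> (forall h, mu (A h) = m%:E) ->
  measurable_fun setT (fun x => (Ex L (fun h => \1_(A h) x))%:E) /\
  (\int[mu]_x (Ex L (fun h => \1_(A h) x))%:E)%E = (m * Ex L (fun _ => 1))%:E.
Proof.
move=> + mA Am; elim: L => [_|[w h] L IH /= /andP[w0 L0]].
  rewrite (_ : (fun _ => _) = cst 0%E).
    by split; [exact: measurable_cst|rewrite integral_cst// mul0e /Ex big_nil mulr0].
  by apply/funext => x; rewrite /Ex big_nil.
have [mL iL] := IH L0.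
have mh : measurable_fun setT (fun x : Borel X => (\1_(A h) x)%:E : \bar R).
  by apply/measurable_EFinP; exact: measurable_indic.
rewrite (_ : (fun _ => _) = fun x => (w%:E * (\1_(A h) x)%:E +
    (Ex L (fun h => \1_(A h) x))%:E)%E); last first.
  by apply/funext => x; rewrite Ex_cons EFinD EFinM.
split.
  by apply: emeasurable_funD => //; exact: measurable_funeM.
rewrite ge0_integralD//.
- rewrite ge0_integralZl//.
  rewrite integral_indic// setIT iL (_ : (_ * _)%E = (w * m)%:E).
    by rewrite -EFinD Ex_cons/=; congr EFin; ring.
  by rewrite EFinM; congr (_ * _)%E; exact: Am.
- by move=> x _; rewrite mule_ge0// lee_fin.
- exact: measurable_funeM.
- by move=> x _; rewrite lee_fin Ex_ge0.
Qed.

(* mu is invariant, so averaging over the translates by L does not change the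
   measure of {t < displacement}, which Markov's inequality bounds by e / t. *)
Lemma concentrating_invariant_measure (mu : probability (Borel X) R) :
  concentrating -> regular_measure mu ->
  (forall g (A : set (Borel X)), measurable A -> mu (act g @^-1` A) = mu A) ->
  mu (~` (fixed_points act : set (Borel X))) = 0%E.
Proof.
move=> conc reg inv.
pose O (j : ((X -> R) * G) * R) : set (Borel X) :=
  [set x | j.2 < (j.1.1 (act j.1.2 x) - j.1.1 x) ^+ 2].
pose D : set (((X -> R) * G) * R) := [set j | unit_fct j.1.1 /\ 0 < j.2].
have Oo j : D j -> open (O j : set X) by move=> [uj _]; exact: open_gt_displacement.
have mO j : D j -> measurable (O j) by move=> /Oo; exact: open_measurable_Borel.
have muO j : D j -> mu (O j) = 0%E.
  move=> Dj; have [uj t0] := Dj.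
  have fO : mu (O j) \is a fin_num by exact: fin_num_measure (mO _ Dj).
  have muA h : mu (act h @^-1` O j) = (fine (mu (O j)))%:E.
    by rewrite fineK// inv//; exact: mO.
  have mA h : measurable (act h @^-1` O j : set (Borel X)).
    apply: open_measurable_Borel; apply: open_comp; last exact: Oo.
    by move=> x _; exact: act_continuous.
  apply/eqP; rewrite eq_le measure_ge0 andbT -(fineK fO) lee_fin.
  apply/ler_addgt0Pl => e e0; rewrite addr0.
  have et0 : 0 < e * j.2 by exact: mulr_gt0.
  have [|L Lp LP] := conc [:: j.1] _ _ et0; first by move=> i; rewrite inE => /eqP ->.
  have [mE iE] := integral_Ex_indic Lp.1 mA muA.
  rewrite -lee_fin -[X in (X%:E <= _)%E]mulr1 -Lp.2 -iE.
  have -> : e%:E = (\int[mu]_x cst e%:E x)%E.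
    rewrite integral_cst// -[LHS]mule1; congr (_ * _)%E.
    by apply/esym; exact: probability_setT.
  apply: ge0_le_integral => //.
    by move=> x _; rewrite lee_fin Ex_ge0//; exact: Lp.1.
  move=> x _; rewrite lee_fin -(ler_pM2r t0).
  apply: le_trans (LP j.1 x (mem_head _ _)).
  rewrite mulrC -ExZ; apply: ler_Ex Lp.1 _ => h.
  rewrite indicE; have [|_] := boolP (x \in _); last by rewrite mulr0 sqr_ge0.
  by rewrite inE mulr1 => /ltW.
have cF : closed (fixed_points act) by exact: closed_fixed_points.
have mF : measurable (~` (fixed_points act : set (Borel X))).
  by apply: open_measurable_Borel; exact: closed_openC.
(* The complement of the fixed points is a possibly uncountable union of null sets [O j]. Inner
   regularity reduces to a compact [K], covered by finitely many of them. *)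
apply/eqP; rewrite eq_le measure_ge0 andbT (reg _ mF).1.
apply: ge_ereal_sup => _ [K [Kc KF] <-].
have mK : measurable (K : set (Borel X)).
  by apply: closed_measurable_Borel; exact: compact_closed.
move: Kc; rewrite compact_cover => /(_ _ D O Oo)[].
  move=> x /KF nfx; rewrite fixed_pointsE in nfx.
  apply: contrapT => nOx; apply: nfx => i ui /=; rewrite leNgt; apply/negP => i0.
  apply: nOx; exists (i, (i.1 (act i.2 x) - i.1 x) ^+ 2 / 2).
    by split=> //=; rewrite divr_gt0.
  by rewrite /O/= ltr_pdivrMr// ltr_pMr// ltr1n.
move=> F FD KO.
have FD' j : j \in finmap.enum_fset F -> D j by move=> jF; exact/set_mem/FD.
suff : mu.-negligible K by move=> /(measure_negligible mK) ->.
apply: (@negligibleS _ _ _ _ (\big[setU/set0]_(j <- finmap.enum_fset F) O j)).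
  by move=> x /KO[j jF Ojx]; rewrite -bigcup_seq; exists j.
elim: (finmap.enum_fset F) FD' => [_|j s IH sD].
  by rewrite big_nil; exact: negligible_set0.
rewrite big_cons; apply: negligibleU.
  have Dj := sD j (mem_head _ _).
  by apply/negligibleP; [exact: mO|exact: muO].
by apply: IH => i si; apply: sD; rewrite inE si orbT.
Qed.

End CompactActions.

Section L0Actions.
Variables (R : realType) (G : topologicalType).
Variables (mul : G -> G -> G) (inv : G -> G) (one : G).
Hypothesis tg : is_topgroup mul inv one.
Local Notation H := (@L0 R G mul one).
Local Notation hmul := (@L0m R G mul one).
Local Notation hinv := (@L0i R G mul inv one).
Local Notation hone := (@L0e R G mul one).

(** The orbit functions over all base points form one right equicontinuous family because
    [act C x = act (C D^-1) (act D x)], where [act D x] is just another point of [X]. *)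
Lemma L0_concentrating (X : ptopologicalType) (act : H -> X -> X) :
  amenable R mul inv one -> compact [set: X] -> continuous_action hmul hone act ->
  concentrating R act.
Proof.
move=> am cX cact s e us e0.
pose Psi : set (H -> R) := [set psi | exists i x, i \in s /\ psi = fun C => i.1 (act C x)].
have aM C D x : act (hmul C D) x = act C (act D x) by case: cact.
have htg := L0_topgroup R tg.
have [|||L Lp LP] := @L0_concentration R G mul inv one tg Psi (map snd s) e am.
- by move=> _ C [i [x [si ->]]]; exact: (us _ si).2.
- move=> eta eta0.
  have := @near_forall_seq _ _ (nbhs hone) _
    (fun (i : (X -> R) * H) g => forall x, `|i.1 (act g x) - i.1 x| <= eta) s
    (fun i si => act_equicontinuous cX cact (us _ si).1 eta0).
  move=> A1; eexists; split; first exact: A1.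
  move=> _ C D [i [x [si ->]]] ACD.
  by have := ACD i si (act D x); rewrite -aM (tg_mulgKV htg).
- exact: e0.
exists L => // i x si.
have -> : (fun h => (i.1 (act i.2 (act h x)) - i.1 (act h x)) ^+ 2) =
          (fun h => (i.1 (act (hmul i.2 h) x) - i.1 (act h x)) ^+ 2).
  by apply/funext => h; rewrite aM.
by apply: (LP (fun C => i.1 (act C x)) i.2); [exists i, x|apply/mapP; exists i].
Qed.

End L0Actions.

(** * The compact space of means *)

Section SetType.
Variables (X : topologicalType) (K : set X).

Lemma compact_set_type : compact K -> compact [set: set_type K].
Proof.
move=> cK F PF _.
have [|m [Km clm]] := cK (set_val @ F) (fmap_proper_filter set_val PF).
  suff : F [set x | K (set_val x)] by [].
  by apply: filterE => x; exact: set_valP.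
exists (exist _ m (mem_set Km)); split=> // A B FA [C [[W Wo <-] /= Wm] WB].
have [|_ [[a Aa <-] Wa]] := clm (set_val @` A) W _ (open_nbhs_nbhs (conj Wo Wm)).
  suff : F [set x | (set_val @` A) (set_val x)] by [].
  by apply: filterS FA => a Aa; exists a.
by exists a; split=> //; exact: WB.
Qed.

Lemma hausdorff_set_type : hausdorff_space X -> hausdorff_space (set_type K).
Proof.
move=> hX p q clpq; apply: val_inj; apply: hX => A B pA qB.
have [||x [Ax Bx]] := clpq (set_val @^-1` A) (set_val @^-1` B).
- exact: (@initial_continuous _ _ (set_val : set_type K -> X) p).
- exact: (@initial_continuous _ _ (set_val : set_type K -> X) q).
by exists (set_val x).
Qed.

End SetType.

Section ClosedSets.
Variable (X : topologicalType).

Lemma continuous_fctD (R : realType) (u v : X -> R) : continuous u -> continuous v ->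
  continuous (fun x => u x + v x).
Proof. by move=> cu cv x; apply: cvgD; [exact: cu|exact: cv]. Qed.

Lemma continuous_fctZ (R : realType) (a : R) (u : X -> R) : continuous u ->
  continuous (fun x => a * u x).
Proof. by move=> cu x; apply: cvgM; [exact: cvg_cst|exact: cu]. Qed.

Lemma continuous_fct_cst (R : realType) (a : R) : continuous (fun _ : X => a).
Proof. by move=> x; exact: cvg_cst. Qed.

Lemma closed_forall (I : Type) (F : I -> set X) :
  (forall i, closed (F i)) -> closed [set x | forall i, F i x].
Proof.
move=> Fc; rewrite (_ : [set x | _] = \bigcap_i F i).
  by apply: closed_bigI => i _.
by apply/seteqP; split=> x Fx i //; exact: Fx.
Qed.

Lemma closed_imply (P : Prop) (F : set X) :
  (P -> closed F) -> closed [set x | P -> F x].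
Proof.
move=> Fc; have [p|np] := pselect P.
  rewrite (_ : [set x | _] = F); first exact: Fc.
  by apply/seteqP; split=> x /=; [exact|].
rewrite (_ : [set x | _] = setT); first exact: closedT.
by apply/seteqP; split=> x // _ /np.
Qed.

Lemma closed_eq_fct (R : realType) (u v : X -> R) : continuous u -> continuous v ->
  closed [set x | u x = v x].
Proof.
move=> cu cv; rewrite (_ : [set x | _] = (fun x => u x - v x) @^-1` [set 0]).
  apply: closed_comp; last exact: closed_eq.
  by move=> x _; apply: cvgB; [exact: cu|exact: cv].
by apply/seteqP; split=> x /= => [->|/subr0_eq//]; rewrite subrr.
Qed.

End ClosedSets.

Section Means.
Variables (R : realType) (H : topologicalType).
Variables (mul : H -> H -> H) (inv : H -> H) (one : H).
Hypothesis tg : is_topgroup mul inv one.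
Local Notation RUC := (@RUCb R H mul inv one).
Let P : topologicalType := prod_topology (fun _ : H -> R => (R : topologicalType)).

(* Vanishing outside RUC_b confines means to a product of compact intervals. *)
Definition means : set P := [set m |
  [/\ (forall f g, RUC f -> RUC g -> m (f \+ g) = m f + m g),
      (forall (a : R) f, RUC f -> m (fun x => a * f x) = a * m f),
      (forall f, RUC f -> (forall x, 0 <= f x) -> 0 <= m f),
      m (fun _ => 1) = 1 &
      (forall f, ~ RUC f -> m f = 0)]].

Lemma mean_norm_le (m : P) f M : means m -> RUC f -> (forall x, `|f x| <= M) ->
  `|m f| <= M.
Proof.
move=> [mD mZ m0 m1 _] Rf fM.
have le f' : RUC f' -> (forall x, f' x <= M) -> m f' <= M.
  move=> Rf' f'M.
  have R1 : RUC (fun _ => M * 1) by exact: RUCb_cst.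
  have R2 : RUC (fun x => -1 * f' x) by exact: RUCbZ.
  have : 0 <= m ((fun _ => M * 1) \+ (fun x => -1 * f' x)).
    by apply: m0 => [|x /=]; [exact: RUCbD|rewrite mulr1 mulN1r subr_ge0].
  rewrite (mD _ _ R1 R2) (mZ M (fun _ => 1)); last exact: RUCb_cst.
  by rewrite mZ// m1 mulr1 mulN1r subr_ge0.
rewrite ler_norml; apply/andP; split; last first.
  by apply: le => // x; exact: le_trans (ler_norm _) (fM x).
rewrite lerNl -mulN1r -mZ//; apply: le; first exact: RUCbZ.
by move=> x; rewrite mulN1r (le_trans _ (fM x))// -normrN ler_norm.
Qed.

Lemma eval_continuous (f : H -> R) : continuous (fun m : P => m f).
Proof. exact: (@proj_continuous _ (fun _ : H -> R => R) f). Qed.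

Lemma closed_means : closed means.
Proof.
rewrite (_ : means =
  [set m | forall f g, RUC f -> RUC g -> m (f \+ g) = m f + m g] `&`
  [set m | forall (a : R) f, RUC f -> m (fun x => a * f x) = a * m f] `&`
  [set m | forall f, RUC f -> (forall x, 0 <= f x) -> 0 <= m f] `&`
  [set m | m (fun _ => 1) = 1] `&` [set m | forall f, ~ RUC f -> m f = 0]).
  repeat apply: closedI.
  - apply: closed_forall => f; apply: closed_forall => g.
    apply: closed_imply => _; apply: closed_imply => _.
    exact: (closed_eq_fct (@eval_continuous (f \+ g))
      (continuous_fctD (@eval_continuous f) (@eval_continuous g))).
  - apply: closed_forall => a; apply: closed_forall => f; apply: closed_imply => _.
    exact: (closed_eq_fct (@eval_continuous (fun x => a * f x))
      (@continuous_fctZ _ _ a _ (@eval_continuous f))).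
  - apply: closed_forall => f; apply: closed_imply => _; apply: closed_imply => _.
    apply: (@closed_comp _ _ (fun m : P => m f) [set y | 0 <= y]); last exact: closed_ge.
    by move=> m _; exact: (@eval_continuous f).
  - exact: (closed_eq_fct (@eval_continuous (fun _ => 1)) (@continuous_fct_cst _ _ 1)).
  - apply: closed_forall => f; apply: closed_imply => _.
    exact: (closed_eq_fct (@eval_continuous f) (@continuous_fct_cst _ _ 0)).
by apply/seteqP; split=> m /=; [case=> *; split|case=> -[[[? ?] ?] ?] ?; split].
Qed.

Lemma compact_means : compact means.
Proof.
pose M f : R := if pselect (RUC f) is left p then sval (cid p.1) else 0.
have MP f x : RUC f -> `|f x| <= M f.
  by move=> Rf; rewrite /M; case: pselect => // p; case: cid.
apply: (@subclosed_compact _ means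
  [set m : P | forall f, `[- M f, M f]%classic (m f)]).
- exact: closed_means.
- apply: (@tychonoff _ (fun _ => R) (fun f => `[- M f, M f]%classic)) => f.
  exact: segment_compact.
- move=> m mm f; rewrite /= in_itv/= -ler_norml.
  have [Rf|nRf] := pselect (RUC f).
    by apply: mean_norm_le => // x; exact: MP.
  by case: mm => _ _ _ _ ->//; rewrite normr0 /M; case: pselect.
Qed.

(** This serves as the base point of the space of means. *)
Lemma eval_mean : means (fun f => if pselect (RUC f) then f one else 0).
Proof.
have val f : RUC f -> (if pselect (RUC f) then f one else 0) = f one.
  by move=> Rf; case: pselect.
split=> [f g Rf Rg|a f Rf|f Rf f0||f nRf].
- by rewrite !val//; exact: RUCbD.
- by rewrite !val//; exact: RUCbZ.
- by rewrite val.
- by rewrite val//; exact: RUCb_cst.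
- by case: pselect.
Qed.

(** The converse direction is what keeps translated means zero outside RUC. *)
Lemma RUCb_translateE g (f : H -> R) : RUC (fun x => f (mul g x)) <-> RUC f.
Proof.
split=> [/(RUCb_translate tg (inv g))|]; last exact: RUCb_translate.
by under eq_fun do rewrite (tg_mulKVg tg).
Qed.

Definition translate_mean (g : H) (m : P) : P := fun f => m (fun x => f (mul g x)).

Lemma translate_means g m : means m -> means (translate_mean g m).
Proof.
move=> [mD mZ m0 m1 mz]; split=> [f h Rf Rh|a f Rf|f Rf f0||f nRf].
- by rewrite /translate_mean mD//; exact/RUCb_translateE.
- by rewrite /translate_mean mZ//; exact/RUCb_translateE.
- by apply: m0 => //; exact/RUCb_translateE.
- exact: m1.
- by apply: mz; rewrite RUCb_translateE.
Qed.

Lemma means_val (x : set_type means) : means (set_val x).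
Proof. exact: set_valP. Qed.

(** Right uniformity matters here: the quotient of [mul g z] by [mul h z] is [g h^-1] for every [z],
    so the translates of [f] vary continuously in sup norm, and means are contractions for that
    norm. *)
Lemma translate_mean_cvg (g : H) (x : set_type means) (f : H -> R) :
  (fun p : H * set_type means => set_val p.2 (fun y => f (mul p.1 y))) @ (g, x) -->
  (set_val x (fun y => f (mul g y)) : R).
Proof.
have [Rf|nRf] := pselect (RUC f); last first.
  have z (p : H * set_type means) : set_val p.2 (fun y => f (mul p.1 y)) = 0.
    by have [_ _ _ _ ->//] := means_val p.2; rewrite RUCb_translateE.
  have -> : (fun p : H * set_type means => set_val p.2 (fun y => f (mul p.1 y))) =
      (fun _ => 0) by apply/funext => p; exact: z.
  by rewrite (z (g, x)); exact: cvg_cst.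
apply/cvgrPdist_le => e e0; have e2 : 0 < e / 2 by rewrite divr_gt0.
have [U [U1 Uf]] := Rf.2 _ e2.
have Rg h : RUC (fun y => f (mul h y)) by exact: RUCb_translate.
have gU : nbhs g [set h | U (mul g (inv h))].
  have : (fun h => mul g (inv h)) @ g --> mul g (inv g).
    by apply: (tg_cvgM tg); [exact: cvg_cst|apply: (tg_cvgV tg); exact: cvg_id].
  by rewrite (tg_mulgV tg); exact.
have xc : nbhs x [set y : set_type means |
    `|set_val x (fun z => f (mul g z)) - set_val y (fun z => f (mul g z))| <= e / 2].
  have : (fun y : set_type means => set_val y (fun z => f (mul g z))) @ x -->
      set_val x (fun z => f (mul g z)).
    apply: (@continuous_comp _ _ _ (set_val : set_type means -> P)
      (fun m : P => m (fun z => f (mul g z)))).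
      exact: (@initial_continuous _ _ (set_val : set_type means -> P) x).
    exact: eval_continuous.
  by move=> /cvgrPdist_le /(_ _ e2).
exists ([set h | U (mul g (inv h))], [set y : set_type means |
    `|set_val x (fun z => f (mul g z)) - set_val y (fun z => f (mul g z))| <= e / 2]) => //.
move=> [h y] /= [Uh ye].
rewrite (le_trans (ler_distD (set_val y (fun z => f (mul g z))) _ _))// (splitr e) lerD//.
have my := means_val y; have [mD mZ _ _ _] := my.
have <- : set_val y ((fun z => f (mul g z)) \+ (fun z => -1 * f (mul h z))) =
    set_val y (fun z => f (mul g z)) - set_val y (fun z => f (mul h z)).
  by rewrite mD ?mZ ?mulN1r//; exact: RUCbZ.
apply: mean_norm_le => //; first by apply: RUCbD => //; exact: RUCbZ.
by move=> z; rewrite /= mulN1r ltW// Uf// (tg_divM tg).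
Qed.

Lemma extremely_amenable_amenable :
  extremely_amenable mul one -> amenable R mul inv one.
Proof.
move=> ea.
pose x0 : set_type means := exist (fun m : P => m \in means) _ (mem_set eval_mean).
pose X : ptopologicalType := HB.pack (set_type means) (isPointed.Build (set_type means) x0).
have meansX (x : X) : means (set_val x) by exact: (set_valP x).
pose act (g : H) (x : X) : X :=
  exist (fun m : P => m \in means) (translate_mean g (set_val x))
    (mem_set (translate_means g (meansX x))).
have [|||x xfix] := ea X act.
- exact: (compact_set_type compact_means).
- apply: hausdorff_set_type; apply: hausdorff_product => _; exact: Rhausdorff.
- split.
  + move=> x; apply: val_inj; apply/funext => f /=; rewrite /translate_mean.
    by congr (set_val x _); apply/funext => y; rewrite (tg_mul1g tg).
  + move=> g h x; apply: val_inj; apply/funext => f /=; rewrite /translate_mean/=.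
    by congr (set_val x _); apply/funext => y; rewrite (tg_mulA tg).
  + apply: (@continuous_comp_initial _ _ _ (set_val : set_type means -> P)) => -[g x].
    apply/cvg_sup => f A [B [[W Wo <-] Wf] WA].
    have fc : (fun p : H * X => set_val p.2 (fun y => f (mul p.1 y))) @ (g, x) -->
        set_val x (fun y => f (mul g y)) by exact: translate_mean_cvg.
    suff : nbhs (g, x) [set p : H * X | A (set_val (act p.1 p.2))] by [].
    have fW : nbhs (g, x) [set p : H * X | W (set_val p.2 (fun y => f (mul p.1 y)))].
      exact: (fc _ (open_nbhs_nbhs (conj Wo Wf))).
    by apply: filterS fW => p Wp; exact: WA.
exists (set_val x); have [mD mZ m0 m1 _] := meansX x.
split=> // f g Rf; have := xfix g => /(congr1 (fun y : X => set_val y f)) /=.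
by rewrite /translate_mean.
Qed.

End Means.

(** * From L^0(G) back to G *)

Section UpperIntegral.
Variable R : realType.
Local Notation lambda := (@lebesgue_measure R).
Local Notation I01 := (`[(0:R), 1]%classic : set R).
Implicit Types u v g : R -> R.

Definition integrable01 g : Prop := lambda.-integrable I01 (EFin \o g).

Lemma lebesgue_I01 : lambda I01 = 1%E.
Proof. by rewrite lebesgue_measure_itv/= lte_fin ltr01 sube0. Qed.

Lemma integrable01D u v : integrable01 u -> integrable01 v ->
  integrable01 (u \+ v).
Proof.
move=> iu iv; rewrite /integrable01.
rewrite (_ : EFin \o _ = (EFin \o u) \+ (EFin \o v))%E; last exact/funext.
by apply: integrableD => //; exact: measurable_itv.
Qed.

Lemma integrable01Z (a : R) u : integrable01 u -> integrable01 (fun x => a * u x).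
Proof.
move=> iu; rewrite /integrable01.
rewrite (_ : EFin \o _ = (fun x => a%:E * (EFin \o u) x))%E; last exact/funext.
by apply: integrableZl => //; exact: measurable_itv.
Qed.

Lemma integrable01_bounded u : measurable_fun I01 u -> bounded_fct u ->
  integrable01 u.
Proof.
move=> mu [M uM]; apply: measurable_bounded_integrable => //.
  by suff : (lambda I01 < +oo)%E by []; rewrite lebesgue_I01 ltry.
by exists M; split; rewrite ?num_real// => N MN x _; exact: le_trans (uM x) (ltW MN).
Qed.

Lemma integrable01_cst (a : R) : integrable01 (fun _ => a).
Proof.
by apply: integrable01_bounded; [exact: measurable_cst|exact: bounded_fct_cst].
Qed.

Lemma Rintegral01_cst (a : R) : \int[lambda]_(x in I01) a = a.
Proof.
rewrite Rintegral_cst// -[RHS]mulr1; congr (_ * _).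
exact: (congr1 fine lebesgue_I01).
Qed.

(* A linear functional below the upper Lebesgue integral on all bounded
   functions on [0,1]; no measurability question arises for f o C. *)
Lemma exists_integral_extension : exists J : (R -> R) -> R,
  [/\ forall u v, bounded_fct u -> bounded_fct v -> J (u \+ v) = J u + J v,
      forall (a : R) u, bounded_fct u -> J (fun x => a * u x) = a * J u &
      forall u g, bounded_fct u -> integrable01 g ->
        (forall x, I01 x -> u x <= g x) -> J u <= \int[lambda]_(x in I01) g x].
Proof.
pose S u r := exists g, [/\ integrable01 g, forall x, I01 x -> u x <= g x &
  r = \int[lambda]_(x in I01) g x].
have [||||J [JD JZ JS]] := @hahn_banach_cone R R S.
- move=> u v _ _ [g [ig ug ->]] [h [ih vh ->]].
  exists (g \+ h); split; first exact: integrable01D.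
    by move=> x x01 /=; rewrite lerD ?ug ?vh.
  by rewrite RintegralD.
- move=> a u _ a0 [g [ig ug ->]].
  exists (fun x => a * g x); split; first exact: integrable01Z.
    by move=> x x01; rewrite ler_pM2l// ug.
  by rewrite RintegralZl.
- move=> u [M uM]; exists (\int[lambda]_(x in I01) M), (fun _ => M).
  split=> //; first exact: integrable01_cst.
  by move=> x _; exact: le_trans (ler_norm _) (uM x).
- by move=> _ [g [ig g0 ->]]; exact: Rintegral_ge0.
exists J; split=> // u g bu ig ug; apply: JS => //.
by exists g.
Qed.

End UpperIntegral.

Section IntegralExtension.
Variables (R : realType) (J : (R -> R) -> R).
Local Notation lambda := (@lebesgue_measure R).
Local Notation I01 := (`[(0:R), 1]%classic : set R).
Implicit Types u v g : R -> R.
Hypothesis JD : forall u v, bounded_fct u -> bounded_fct v -> J (u \+ v) = J u + J v.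
Hypothesis JZ : forall (a : R) u, bounded_fct u -> J (fun x => a * u x) = a * J u.
Hypothesis Jle : forall u g, bounded_fct u -> integrable01 g ->
  (forall x, I01 x -> u x <= g x) -> J u <= \int[lambda]_(x in I01) g x.

Lemma J_le_defect u (a b : R) (P : R -> Prop) : bounded_fct u -> 0 <= b ->
  (forall x, I01 x -> P x -> u x <= a) -> (forall x, I01 x -> u x <= a + b) ->
  J u <= a + b * fine (defect P).
Proof.
move=> bu b0 uP ub; apply/ler_addgt0Pr => e e0.
have b1 : 0 < b + 1 by rewrite ltr_wpDl.
have e'0 : 0 < e / (b + 1) by rewrite divr_gt0.
have [W [Wo PW Wle]] := outer_measure_open_le [set x | I01 x /\ ~ P x] e'0.
have mW : measurable (W : set R) by exact: open_measurable.
have iW : integrable01 (\1_W : R -> R).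
  apply: integrable01_bounded; first exact: measurable_indic.
  by exists 1 => x; rewrite indicE; case: (_ \in _); rewrite ?normr1// normr0.
apply: (@le_trans _ _ (\int[lambda]_(x in I01) (a + b * \1_W x))).
  apply: Jle => //.
    exact: (integrable01D (integrable01_cst a) (integrable01Z b iW)).
  move=> x x01; have [Px|nPx] := pselect (P x).
    by rewrite (le_trans (uP x x01 Px))// lerDl mulr_ge0.
  rewrite indicE mem_set ?mulr1; first exact: ub.
  exact: PW.
rewrite RintegralD//; [|exact: integrable01_cst|exact: integrable01Z].
rewrite Rintegral01_cst RintegralZl// -addrA lerD2l.
have le1 : \int[lambda]_(x in I01) (\1_W x : R) <= fine (defect P) + e / (b + 1).
  rewrite /Rintegral integral_indic// -lee_fin fineK.
    rewrite EFinD fineK ?defect_fin_num//; apply: le_trans Wle.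
    by apply: le_lebesgue_outer; exact: subIsetl.
  rewrite ge0_fin_numE//; apply: (@le_lt_trans _ _ (lambda I01)).
    by apply: le_lebesgue_outer; exact: subIsetr.
  by suff : (lambda I01 < +oo)%E by []; rewrite lebesgue_I01 ltry.
rewrite (le_trans (ler_wpM2l b0 le1))// mulrDr lerD2l mulrA ler_pdivrMr//.
by rewrite mulrC ler_pM2l// lerDl.
Qed.

Lemma JB u v : bounded_fct u -> bounded_fct v -> J (fun x => u x - v x) = J u - J v.
Proof.
move=> bu bv; rewrite -[X in _ + X]mulN1r -JZ// -JD//; last exact: bounded_fctZ.
by congr J; apply/funext => x /=; rewrite mulN1r.
Qed.

Lemma bounded_fctB u v : bounded_fct u -> bounded_fct v ->
  bounded_fct (fun x => u x - v x).
Proof.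
move=> bu bv; rewrite (_ : (fun _ => _) = u \+ (fun x => -1 * v x)).
  by apply: bounded_fctD => //; exact: bounded_fctZ.
by apply/funext => x /=; rewrite mulN1r.
Qed.

Lemma J_dist_le u v (a M : R) (P : R -> Prop) : 0 <= a ->
  (forall x, `|u x| <= M) -> (forall x, `|v x| <= M) ->
  (forall x, I01 x -> P x -> `|u x - v x| <= a) ->
  `|J u - J v| <= a + (M + M) * fine (defect P).
Proof.
move=> a0 uM vM uvP.
have bu : bounded_fct u by exists M.
have bv : bounded_fct v by exists M.
have M0 : 0 <= M by exact: le_trans (normr_ge0 _) (uM 0).
have half u' v' : bounded_fct u' -> bounded_fct v' ->
    (forall x, `|u' x| <= M) -> (forall x, `|v' x| <= M) ->
    (forall x, I01 x -> P x -> `|u' x - v' x| <= a) ->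
    J u' - J v' <= a + (M + M) * fine (defect P).
  move=> bu' bv' u'M v'M uvP'; rewrite -JB//; apply: J_le_defect.
  - exact: bounded_fctB.
  - exact: addr_ge0.
  - by move=> x x01 Px; exact: le_trans (ler_norm _) (uvP' x x01 Px).
  - move=> x _; apply: le_trans (ler_norm _) _; apply: le_trans (ler_normB _ _) _.
    by rewrite ler_wpDl// lerD.
rewrite ler_norml half// andbT lerNl opprB half// => x x01 Px.
by rewrite distrC uvP.
Qed.

Lemma J_le_cst u (a : R) : bounded_fct u -> (forall x, u x <= a) -> J u <= a.
Proof.
move=> bu ua; have := @J_le_defect u a 0 (fun _ => True) bu (lexx 0).
by rewrite mul0r addr0; apply=> x _; rewrite ?addr0.
Qed.

Lemma J_ge0 u : bounded_fct u -> (forall x, 0 <= u x) -> 0 <= J u.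
Proof.
move=> bu u0; rewrite -oppr_le0 -mulN1r -JZ//; apply: J_le_cst.
  exact: bounded_fctZ.
by move=> x; rewrite mulN1r oppr_le0.
Qed.

Lemma J1 : J (fun _ => 1) = 1.
Proof.
have b1 := bounded_fct_cst R (1 : R).
apply/eqP; rewrite eq_le J_le_cst//= -lerN2 -[leLHS]mulN1r -JZ//.
by apply: J_le_cst => [|x]; [exact: bounded_fctZ|rewrite mulr1].
Qed.

End IntegralExtension.

Section AmenableL0.
Variables (R : realType) (G : topologicalType).
Variables (mul : G -> G -> G) (inv : G -> G) (one : G).
Hypothesis tg : is_topgroup mul inv one.
Local Notation H := (@L0 R G mul one).
Local Notation hmul := (@L0m R G mul one).
Local Notation hinv := (@L0i R G mul inv one).
Local Notation hone := (@L0e R G mul one).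
Local Notation rep := (@L0rep R G).

Lemma amenable_L0_amenable : amenable R hmul hinv hone -> amenable R mul inv one.
Proof.
move=> [m [mD mZ m0 m1 mI]].
have [J [JD JZ Jle]] := exists_integral_extension R.
pose hat (f : G -> R) (C : H) := J (fun x => f (rep C x)).
have bf f (C : H) : RUCb mul inv one f -> bounded_fct (fun x => f (rep C x)).
  by move=> [[M fM] _]; exists M.
have hatR f : RUCb mul inv one f -> RUCb hmul hinv hone (hat f).
  move=> Rf; have [[M fM] fc] := Rf; split.
    exists M => C; rewrite ler_norml; apply/andP; split.
      rewrite lerNl -mulN1r -JZ; last exact: bf.
      apply: (J_le_cst Jle); first by apply: bounded_fctZ; exact: bf.
      by move=> x; rewrite mulN1r (le_trans _ (fM (rep C x)))// -normrN ler_norm.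
    apply: (J_le_cst Jle); first exact: bf.
    by move=> x; exact: le_trans (ler_norm _) (fM _).
  move=> e e0; have e2 : 0 < e / 2 by rewrite divr_gt0.
  have [U [U1 Uf]] := fc _ e2.
  have M0 : 0 <= M by exact: le_trans (normr_ge0 _) (fM one).
  have M1 : 0 < M + M + 1 by rewrite ltr_wpDl ?addr_ge0.
  have d0 : 0 < e / 2 / (M + M + 1) by rewrite divr_gt0.
  (* An exceptional set costs at most [M + M] times its measure; the added 1 avoids a division by
     zero. *)
  exists (L0N U° (e / 2 / (M + M + 1))); split.
    apply/(L0_nbhs1P tg); exists U°, (e / 2 / (M + M + 1)).
    by split=> //; exact: open_interior.
  move=> C D; rewrite (L0N_defect _ _ (L0ae_div tg (L0ae_refl _) (L0ae_refl _))).
  set P := fun x => U° _ => Pd.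
  apply: (@le_lt_trans _ _ (e / 2 + (M + M) * fine (defect P))).
    apply: (J_dist_le JD JZ Jle (ltW e2)) => [x|x|x _ /interior_subset Px];
      [exact: fM|exact: fM|exact/ltW/Uf].
  rewrite [ltRHS](splitr e) ltrD2l.
  have Pd' : fine (defect P) < e / 2 / (M + M + 1).
    by rewrite -lte_fin fineK// defect_fin_num.
  apply: (@le_lt_trans _ _ ((M + M + 1) * fine (defect P))).
    by rewrite ler_wpM2r ?lerDl// fine_ge0// defect_ge0.
  by rewrite -ltr_pdivlMl// mulrC.
exists (fun f => m (hat f)); split.
- move=> f g Rf Rg; rewrite -mD; [|exact: hatR|exact: hatR]; congr m.
  by apply/funext => C; rewrite /hat/= -JD//; exact: bf.
- move=> a f Rf; rewrite -mZ; last exact: hatR.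
  by congr m; apply/funext => C; rewrite /hat/= -JZ//; exact: bf.
- move=> f Rf f0; apply: m0; first exact: hatR.
  by move=> C; apply: (J_ge0 JZ Jle) => //; exact: bf.
- by rewrite -[RHS]m1; congr m; apply/funext => C; rewrite /hat (J1 JZ Jle).
(* [G] sits in its [L0] as the constant maps. The representative of [hmul K C] is [mul g (rep C x)]
   only almost everywhere, but [J] ignores null sets. *)
- move=> f g Rf; pose K : H := L0of one (fun _ => g).
  have Kg : ae_eq (rep K) (fun _ => g).
    by apply: L0rep_of; exact: strongly_measurable_cst.
  rewrite -(mI (hat f) K); last exact: hatR.
  congr m; apply/funext => C; have [[M fM] _] := Rf.
  apply/eqP; rewrite -subr_eq0 -normr_le0.
  have ae := L0ae_trans (L0rep_mul tg K C) (L0ae_map2 mul Kg (L0ae_refl _)).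
  apply: (@le_trans _ _ (0 + (M + M) *
      fine (defect (fun x => rep (hmul K C) x = mul g (rep C x))))).
    apply: (J_dist_le JD JZ Jle (lexx 0)) => [x|x|x _ ->]; [exact: fM|exact: fM|].
    by rewrite subrr normr0.
  by move: ae; rewrite L0ae_defect => ->; rewrite /= mulr0 addr0.
Qed.

End AmenableL0.

Theorem theorem1p1 (R : realType) (G : topologicalType)
  (mul : G -> G -> G) (inv : G -> G) (one : G) :
  is_topgroup mul inv one ->
  [<-> amenable R mul inv one;
       amenable R (@L0m R G mul one) (@L0i R G mul inv one) (@L0e R G mul one);
       extremely_amenable (@L0m R G mul one) (@L0e R G mul one);
       whirly_amenable R (@L0m R G mul one) (@L0i R G mul inv one)
         (@L0e R G mul one)].
Proof.
move=> tg; have htg := L0_topgroup R tg.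
have am_ext : amenable R mul inv one ->
    extremely_amenable (@L0m R G mul one) (@L0e R G mul one).
  move=> am X act cX hX cact.
  exact: (concentrating_fixed_point cX hX cact (L0_concentrating tg am cX cact)).
have ext_am : extremely_amenable (@L0m R G mul one) (@L0e R G mul one) ->
    amenable R (@L0m R G mul one) (@L0i R G mul inv one) (@L0e R G mul one).
  exact: extremely_amenable_amenable.
have L0_am := @amenable_L0_amenable R G mul inv one tg.
(* The implications towards extreme and whirly amenability first descend to amenability of [G], the
   hypothesis of the concentration result. *)
tfae.
- by move=> /am_ext/ext_am.
- by move=> /L0_am/am_ext.
- move=> ext; split; first exact: ext_am.
  move=> X act cX hX cact mu reg inva.
  have am := L0_am (ext_am ext).
  exact: (concentrating_invariant_measure cX hX cact
    (L0_concentrating tg am cX cact) reg inva).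
- by move=> [/L0_am].
Qed.
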